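(* Let $X$ be a Fréchet sequence algebra for the coordinatewise product, with a continuous norm and admitting $(e_n)_{n\ge 0}$ as an unconditional basis. Let $I\subset\mathbb R$ be a nonempty interval, let $d\geq1$ and let $\Lambda\subset I^d$ be $\sigma$-compact. Let $(B_{w(a)})_{a\in I}$ be a family of weighted shifts on $X$, induced by a continuous family $(w(a))_{a\in I}$ of admissible weights, and assume that, for each $n\ge 1$, $a\in I\mapsto w_n(a)$ is non-decreasing, and that $\inf_{n\geq 1,\,a\in I}w_n(a)>0$. Also assume that there exist a non-decreasing $F:\mathbb N\to(0,+\infty)$ and $c,C>0$ such that, for all $n\geq1$, writing $f_n(a)=\sum_{k=1}^n\log(w_k(a))$, $$\forall (a,b)\in I^2,\quad cF(n)|a-b|\leq|f_n(a)-f_n(b)|\leq CF(n)|b-a|,$$ $$\forall (a,b)\in I^2,\quad \frac{w_n(a)}{w_n(b)}\geq c.$$ Then the following assertions are equivalent: (a) the family $(B_{w(\lambda(1))}\times\cdots\times B_{w(\lambda(d))})_{\lambda\in\Lambda}$ admits a common hypercyclic algebra in $X^d$; (b) for all $m\geq1$, there exists $u\in X^d$ such that $u^m$ is a common hypercyclic vector for $(B_{w(\lambda(1))}\times\cdots\times B_{w(\lambda(d))})_{\lambda\in\Lambda}$; (c) for all integers $m\geq 1$, all $\tau>0$, all integers $N\geq1$, all $\varepsilon>0$ and all compact sets $K\subset\Lambda$, there exist $q\ge 1$, integers $N\leq n_1<n_1+N\leq n_2<\dots<n_{q-1}+N\leq n_q$ and $(\lambda_k)_{k=1,\dots,q}\in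 (I^d)^q$ such that (i) $K\subset\bigcup_{k=1}^q\prod_{l=1}^d\left[\lambda_k(l)-\frac{\tau}{F(n_k)},\lambda_k(l)\right]$; (ii) for all $i=1,\dots,d$, $$\left\|\sum_{k=1}^q\frac{1}{\big[w_1(\lambda_k(i))\cdots w_{n_k}(\lambda_k(i))\big]^{1/m}}\,e_{n_k}\right\|<\varepsilon;$$ (iii) for all $k=1,\dots,q$, all $i=1,\dots,d$ and all $l=0,\dots,N$, $$\left\|\sum_{j=k+1}^q\frac{w_{n_j-n_k+l+1}(\lambda_k(i))\cdots w_{n_j+l}(\lambda_k(i))}{w_{l+1}(\lambda_j(i))\cdots w_{n_j+l}(\lambda_j(i))}\,e_{n_j-n_k+l}\right\|<\varepsilon.$$
   Context: Let $\omega$ be the space of all complex sequences $(x_n)_{n\geq0}$ and let $e_i$ be the sequence with $1$ in position $i$ and $0$ elsewhere. A Fréchet sequence algebra is a Fréchet space $X\subset\omega$ (continuously included in $\omega$), whose complete topology is induced by a non-decreasing separating sequence of seminorms $(\|\cdot\|_q)_{q\geq1}$, endowed with a well-defined product $\cdot$ such that $\|x\cdot y\|_q\leq\|x\|_q\|y\|_q$ for all $x,y\in X$ and $q\geq1$. The coordinatewise product is $(a_n)_n\cdot(b_n)_n=(a_nb_n)_n$; $X^d$ is an algebra with this product applied in each of its $d$ components, and $u^m$ denotes the $m$-th power in this algebra. ''With a continuous norm'' means that there is a norm on $X$ which is continuous for its topology. The symbol $\|\cdot\|$ (without index) denotes the $F$-norm of $X$ inducing its topology; it satisfies, for all $u\in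 X$ and $\lambda\in\mathbb C$: $|\lambda|\leq1\Rightarrow\|\lambda u\|\leq\|u\|$; $\lim_{\lambda\to0}\|\lambda u\|=0$; $\|\lambda u\|\leq(|\lambda|+1)\|u\|$. A weight is a sequence $w=(w_n)_{n\geq 1}$ of positive real numbers; the weighted backward shift is $B_w(x_0,x_1,x_2,\dots)=(w_1x_1,w_2x_2,\dots)$, and $w$ is admissible if $B_w$ is a well-defined continuous operator on $X$. We write $w(a)=(w_n(a))_{n\geq1}$. An element $\lambda\in I^d$ is written $\lambda=(\lambda(1),\dots,\lambda(d))$, and $T_\lambda=B_{w(\lambda(1))}\times\cdots\times B_{w(\lambda(d))}$ acts componentwise on $X^d$. The family is a continuous family: each $a\mapsto w_n(a)$ is continuous and $(\lambda,v)\mapsto T_\lambda(v)$ is continuous from $\Lambda\times X^d$ into $X^d$. A vector $x$ is hypercyclic for an operator $T$ if $\{T^n(x):n\geq 1\}$ is dense in the space; $HC(T)$ is the set of hypercyclic vectors of $T$. A common hypercyclic vector for $(T_\lambda)_{\lambda\in\Lambda}$ is an element of $\bigcap_{\lambda\in\Lambda}HC(T_\lambda)$. A common hypercyclic algebra for the family is a non-trivial (i.e. nonzero) subalgebra $A$ of $X^d$ with $A\setminus\{0\}\subset\bigcap_{\lambda\in\Lambda}HC(T_\lambda)$. *)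

(* Defs.v *)
From HB Require Import structures.
From mathcomp Require Import all_boot all_order all_algebra.
From mathcomp Require Import all_classical all_reals all_analysis.
From mathcomp Require Import complex.

Set Implicit Arguments.
Unset Strict Implicit.
Unset Printing Implicit Defensive.

Import Order.TTheory GRing.Theory Num.Theory.
Import numFieldNormedType.Exports.
(* [nat -> R[i]^o], ['I_d -> R] and ['I_d -> X] carry the product topology. *)
Import ArrowAsProduct.

Local Open Scope classical_set_scope.
Local Open Scope complex_scope.
Local Open Scope ring_scope.

Notation modulus := ComplexField.Normc.normc.

(* The inclusion of the algebra in the space of all complex sequences is the
   injective continuous linear map [seqcoord]; [R[i]^o] is [R[i]] with its usual
   topology.  [entourage_seminorm] says that the seminorms induce the uniform
   structure, hence also the topology and the Cauchy filters.
   The seminorms are numbered from 0. *)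
HB.mixin Record isFrechetSequenceAlgebra (R : realType) X
    & Uniform X & GRing.Lmodule R[i] X := {
  seqcoord : X -> (nat -> R[i]^o) ;
  seqcoord_linear : linear seqcoord ;
  seqcoord_injective : injective seqcoord ;
  seqcoord_continuous : continuous seqcoord ;
  seminorm : nat -> X -> R ;
  seminorm_triangle : forall q x y,
    seminorm q (x + y) <= seminorm q x + seminorm q y ;
  seminormZ : forall q (a : R[i]) x,
    seminorm q (a *: x) = modulus a * seminorm q x ;
  seminorm_nondecreasing : forall q x, seminorm q x <= seminorm q.+1 x ;
  seminorm_separating : forall x, (forall q, seminorm q x = 0) -> x = 0 ;
  entourage_seminorm : forall A : set (X * X),
    entourage A <->
    exists q (eps : R),
      0 < eps /\ (forall x y, seminorm q (x - y) < eps -> A (x, y)) ;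
  frechet_complete : forall G : set_system X, ProperFilter G -> cauchy G ->
    exists x : X, G --> x ;
  seqmul : X -> X -> X ;
  seqcoord_seqmul : forall x y n,
    seqcoord (seqmul x y) n = seqcoord x n * seqcoord y n ;
  seminorm_seqmul : forall q x y,
    seminorm q (seqmul x y) <= seminorm q x * seminorm q y
}.

#[short(type="frechetSequenceAlgebraType")]
HB.structure Definition FrechetSequenceAlgebra (R : realType) :=
  {X of Tvs R[i] X & isFrechetSequenceAlgebra R X}.

Definition is_norm (R : realType) (E : lmodType R[i]) (N : E -> R) : Prop :=
  [/\ forall x y, N (x + y) <= N x + N y,
      forall (a : R[i]) x, N (a *: x) = modulus a * N x &
      forall x, N x = 0 -> x = 0].

Definition has_continuous_norm (R : realType) (E : tvsType R[i]) : Prop :=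
  exists N : E -> R, is_norm N /\ continuous N.

Record is_Fnorm (R : realType) (E : tvsType R[i]) (N : E -> R) : Prop := {
  Fnorm_ge0 : forall u, 0 <= N u ;
  Fnorm_eq0 : forall u, N u = 0 -> u = 0 ;
  Fnorm_triangle : forall u v, N (u + v) <= N u + N v ;
  Fnorm_scale_le1 : forall (a : R[i]) u, modulus a <= 1 -> N (a *: u) <= N u ;
  Fnorm_scale_cvg0 : forall u, (fun a : R[i]^o => N (a *: u)) @ 0 --> 0 ;
  Fnorm_scale : forall (a : R[i]) u, N (a *: u) <= (modulus a + 1) * N u ;
  Fnorm_nbhs : forall u (A : set E),
    nbhs u A <->
    exists eps : R, 0 < eps /\ (forall v, N (u - v) < eps -> A v)
}.

Definition schauder_basis (R : realType) (E : tvsType R[i]) (e : nat -> E)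
    : Prop :=
  forall x : E, exists! a : nat -> R[i],
    series (fun k => a k *: e k) @ \oo --> x.

Definition unconditional_basis (R : realType) (E : tvsType R[i]) (e : nat -> E)
    : Prop :=
  schauder_basis e /\
  forall (x : E) (a : nat -> R[i]), series (fun k => a k *: e k) @ \oo --> x ->
    forall s : nat -> nat, bijective s ->
      series (fun k => a (s k) *: e (s k)) @ \oo --> x.

Definition sigma_compact (T : topologicalType) (A : set T) : Prop :=
  exists K : nat -> set T, (forall n, compact (K n)) /\ A = \bigcup_n K n.

Definition hypercyclic (T : topologicalType) (f : T -> T) (x : T) : Prop :=
  dense [set iter n f x | n in [set n | (1 <= n)%N]].

Definition common_hypercyclic (T : topologicalType) (L : Type) (D : set L)
    (f : L -> T -> T) : set T :=
  \bigcap_(l in D) [set x | hypercyclic (f l) x].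

Section FrechetSequenceAlgebraTheory.
Variables (R : realType) (X : frechetSequenceAlgebraType R).

Definition unit_vectors (e : nat -> X) : Prop :=
  forall n k, seqcoord (e n) k = (k == n)%:R.

(* Weights are indexed from 1: the value at 0 is never used. *)
Definition is_shift (w : nat -> R) (x y : X) : Prop :=
  forall n, seqcoord y n = (w n.+1)%:C * seqcoord x n.+1.

(* The default value 0 is only taken when the shifted sequence is not in X,
   which [admissible] excludes. *)
Definition wshift (w : nat -> R) (x : X) : X := xget 0 (is_shift w x).

Definition admissible (w : nat -> R) : Prop :=
  [/\ forall n, (1 <= n)%N -> 0 < w n,
      forall x, exists y, is_shift w x y &
      continuous (wshift w)].

Section Power.
Variable d : nat.

Definition wshift_prod (w : R -> nat -> R) (lam : 'I_d -> R)
    (v : 'I_d -> X) : 'I_d -> X :=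
  fun i => wshift (w (lam i)) (v i).

Definition continuous_family (I : set R) (Lam : set ('I_d -> R))
    (w : R -> nat -> R) : Prop :=
  (forall n, (1 <= n)%N -> {within I, continuous (fun a => w a n)}) /\
  {within Lam `*` [set: 'I_d -> X],
    continuous (fun z => wshift_prod w z.1 z.2)}.

Definition mul_prod (u v : 'I_d -> X) : 'I_d -> X :=
  fun i => seqmul (u i) (v i).

(* The algebra need not have a unit: [pow_prod u m] is meant for m >= 1. *)
Definition pow_prod (u : 'I_d -> X) (m : nat) : 'I_d -> X :=
  iterop m mul_prod u 0.

Definition subalgebra (A : set ('I_d -> X)) : Prop :=
  [/\ A 0,
      forall u v, A u -> A v -> A (u + v),
      forall (a : R[i]) u, A u -> A (a *: u) &
      forall u v, A u -> A v -> A (mul_prod u v)].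

Definition common_hypercyclic_algebra (Lam : set ('I_d -> R))
    (w : R -> nat -> R) (A : set ('I_d -> X)) : Prop :=
  [/\ subalgebra A, exists u, A u /\ u <> 0 &
      A `\ 0 `<=` common_hypercyclic Lam (wshift_prod w)].

End Power.
End FrechetSequenceAlgebraTheory.

(* Main.v *)
Require Import Defs.
From HB Require Import structures.
From mathcomp Require Import all_boot all_order all_algebra.
From mathcomp Require Import all_classical all_reals all_analysis.
From mathcomp Require Import complex.
From mathcomp Require Import zify ring lra.

Import Order.TTheory GRing.Theory Num.Theory.
Import numFieldNormedType.Exports.
Import ArrowAsProduct.

Local Open Scope classical_set_scope.
Local Open Scope complex_scope.
Local Open Scope ring_scope.

(* All topological facts about [X] are reduced to one domination principle: a
   gliding hump argument turns unconditionality of the basis into "small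
   coordinatewise majorant implies small vector".

   (b) => (c): let [v = u^m] be a common hypercyclic vector and aim at the target
   [y = e_0 + ... + e_N] at times that are multiples of [N+1]; such times exist
   because one can build a vector whose orbit visits [y] in every residue class.
   At a given time [n], the parameters in [K] whose orbit is near [y] form a
   compact set contained in a box of side [tau / F n], and finitely many such
   sets cover [K].  The corners of the boxes are attained coordinatewise inside
   these sets, so that (ii) is dominated by a tail of [u] and (iii) by
   [T^n v - y].

   (c) => (a): it suffices that the vectors [u] for which [T^n (u^m)] is near [y]
   and [T^n (u^r)] is small for [m < r <= t], for some [n] depending on the
   parameter in a compact set, are dense; Baire's argument then yields [u]
   generating the algebra.  Such [u] near [x] are obtained by adding, for every
   [k], an [m]-th root of the weighted forward translate of [y] by [n_k - p],
   where [p] bounds the supports: translating by [n_k - p] rather than [n_k]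
   makes this block a backward shift of the sum in (ii). *)

Set Implicit Arguments.
Unset Strict Implicit.
Unset Printing Implicit Defensive.

(** * Seminorms and coordinates *)

(** The continuous norm enters through a single fact: from some index [q0] on, each seminorm bounds
    every coordinate with constant 1. Hence finite pieces can be cut off a vector at a controlled
    cost, and a small vector has all its coordinates below 1, so that raising it to a higher power
    only shrinks it coordinatewise.

    Condition (iii) uses one parameter [lam_k] per block, while orbits are needed at every parameter
    of a box. Monotonicity of the weights settles this: [lam_k] is the upper corner, so its weights
    majorize those of the whole box. The comparisons left over involve either at most [p] weights,
    where the bounds on the weights and on their ratios suffice, or parameters at distance at most
    [tau / F n], where the Lipschitz bound applies.

    Multiples of [N + 1] are imposed because (c) asks for gaps of at least [N], whereas the return
    times come from a compactness argument that says nothing about the gaps between them. *)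

Lemma modulus_ge0 (R : rcfType) (z : R[i]) : 0 <= modulus z.
Proof. by case: z => a b; rewrite /= sqrtr_ge0. Qed.

Lemma modulus_real (R : rcfType) (r : R) : modulus r%:C = `|r|.
Proof. by rewrite /= expr0n /= addr0 sqrtr_sqr. Qed.

Lemma modulusX (R : rcfType) (z : R[i]) m : modulus (z ^+ m) = modulus z ^+ m.
Proof.
elim: m => [|m IH]; first by rewrite !expr0 ComplexField.Normc.normc1.
by rewrite !exprS ComplexField.Normc.normcM IH.
Qed.

Lemma modulusD (R : rcfType) (y z : R[i]) : modulus (y + z) <= modulus y +
  modulus z.
Proof. by rewrite -lecR rmorphD /=; exact: (ler_normD y z). Qed.

Lemma modulus_distC (R : rcfType) (y z : R[i]) : modulus (y - z) = modulus (z -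
  y).
Proof.
rewrite -opprB -[- (z - y)]mulN1r ComplexField.Normc.normcM.
by rewrite -[-1](rmorphN1 (real_complex R)) modulus_real normrN1 mul1r.
Qed.

Section Seminorms.
Variables (R : realType) (X : frechetSequenceAlgebraType R).
Implicit Types (x y z : X) (q : nat).

Lemma seminorm0 q : seminorm q (0 : X) = 0.
Proof.
by rewrite -(scale0r (0 : X)) seminormZ ComplexField.Normc.normc0 mul0r.
Qed.

Lemma seminormN q x : seminorm q (- x) = seminorm q x.
Proof.
rewrite -scaleN1r seminormZ -[-1](rmorphN1 (real_complex R)) modulus_real.
by rewrite normrN1 mul1r.
Qed.

Lemma seminorm_ge0 q x : 0 <= seminorm q x.
Proof.
have := seminorm_triangle q x (- x).
by rewrite subrr seminorm0 seminormN; lra.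
Qed.

Lemma seminorm_distC q x y : seminorm q (x - y) = seminorm q (y - x).
Proof. by rewrite -seminormN opprB. Qed.

Lemma seminorm_sum q (J : Type) (r : seq J) (P : pred J) (f : J -> X) :
  seminorm q (\sum_(j <- r | P j) f j) <= \sum_(j <- r | P j) seminorm q (f j).
Proof.
elim/big_rec2: _ => [|j y x _ h]; first by rewrite seminorm0.
by apply: le_trans (seminorm_triangle _ _ _) _; rewrite lerD2l.
Qed.

Lemma seminorm_le q q' x : (q <= q')%N -> seminorm q x <= seminorm q' x.
Proof.
move=> /subnK <-; elim: (q' - q)%N => [|n IH]; first by rewrite add0n.
by rewrite addSn; apply: le_trans IH (seminorm_nondecreasing _ _).
Qed.

Lemma seminormB q x y z :
  seminorm q (x - z) <= seminorm q (x - y) + seminorm q (y - z).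
Proof. by have := seminorm_triangle q (x - y) (y - z); rewrite addrA subrK. Qed.

Lemma seqcoordD x y n : seqcoord (x + y) n = seqcoord x n + seqcoord y n.
Proof. by have := seqcoord_linear 1 x y; rewrite !scale1r => ->. Qed.

Lemma seqcoord0 n : seqcoord (0 : X) n = 0.
Proof.
by have := seqcoordD 0 0 n; rewrite addr0 => /eqP;
  rewrite addrC -subr_eq subrr => /eqP.
Qed.

Lemma seqcoordZ (a : R[i]) x n : seqcoord (a *: x) n = a * seqcoord x n.
Proof.
have := seqcoord_linear a x 0; rewrite addr0 => ->.
by rewrite -[RHS]addr0 -(seqcoord0 n).
Qed.

Lemma seqcoordN x n : seqcoord (- x) n = - seqcoord x n.
Proof. by rewrite -scaleN1r seqcoordZ mulN1r. Qed.

Lemma seqcoordB x y n : seqcoord (x - y) n = seqcoord x n - seqcoord y n.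
Proof. by rewrite seqcoordD seqcoordN. Qed.

Lemma seqcoord_sum (J : Type) (r : seq J) (P : pred J) (f : J -> X) n :
  seqcoord (\sum_(j <- r | P j) f j) n = \sum_(j <- r | P j) seqcoord (f j) n.
Proof.
by elim/big_rec2: _ => [|j y x _ h]; rewrite ?seqcoord0 // seqcoordD h.
Qed.

Lemma seqcoord_ext x y : (forall n, seqcoord x n = seqcoord y n) -> x = y.
Proof. by move=> h; apply: seqcoord_injective; apply/funext. Qed.

Lemma seminorm_nbhsP x (A : set X) : nbhs x A <->
  exists q (eps : R), 0 < eps /\ forall y, seminorm q (y - x) < eps -> A y.
Proof.
split=> [/nbhsP [B /entourage_seminorm [q [eps [e0 hB]]] BA]|[q [eps [e0 hA]]]].
  exists q, eps; split=> // y hy; apply: BA; apply/xsectionP.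
  by apply: hB; rewrite seminorm_distC.
apply/nbhsP; exists [set xy | seminorm q (xy.1 - xy.2) < eps].
  by apply/entourage_seminorm; exists q, eps; split.
by move=> y /xsectionP /= hy; apply: hA; rewrite seminorm_distC.
Qed.

Lemma seminorm_ball_nbhs q x (eps : R) :
  0 < eps -> nbhs x [set y | seminorm q (y - x) < eps].
Proof. by move=> e0; apply/seminorm_nbhsP; exists q, eps. Qed.

Lemma prod_nbhsP d (f : 'I_d -> X) (A : set ('I_d -> X)) : nbhs f A <->
  exists q (eps : R),
    0 < eps /\ forall g, (forall i, seminorm q (g i - f i) < eps) -> A g.
Proof.
split; last first.
  move=> [q [eps [e0 hA]]].
  have : nbhs f [set g : 'I_d -> X | forall i, seminorm q (g i - f i) < eps].
    have FF : Filter (nbhs f) by exact: nbhs_filter.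
    apply: (@filter_forall _ _ (fun i => [set g : 'I_d ->
      X | seminorm q (g i - f i) < eps]) _ FF) => i.
    have := @proj_continuous _ (fun _ : 'I_d => X) i f.
    by move=> /(_ [set y | seminorm q (y - f i) < eps]); apply;
      exact: seminorm_ball_nbhs.
  by apply: filterS => g; exact: hA.
(* The sets containing a seminorm box around [f] form a filter. The product topology is a supremum,
   so it is enough that this filter converges to [f] in each coordinate. *)
pose G : set_system ('I_d -> X) := [set A | exists q (eps : R),
    0 < eps /\ forall g, (forall i, seminorm q (g i - f i) < eps) -> A g].
have FG : Filter G.
  split.
  - by exists 0%N, 1; split.
  - move=> P Q [q1 [e1 [e10 h1]]] [q2 [e2 [e20 h2]]].
    exists (maxn q1 q2), (Num.min e1 e2); split; first by rewrite lt_min e10.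
    move=> g hg; split; [apply: h1|apply: h2] => i.
      by have := hg i; rewrite lt_min => /andP[+ _]; apply: le_lt_trans;
        apply: seminorm_le; rewrite leq_maxl.
    by have := hg i; rewrite lt_min => /andP[_]; apply: le_lt_trans;
      apply: seminorm_le; rewrite leq_maxr.
  - move=> P Q PQ [q [eps [e0 h]]]; exists q, eps; split=> // g /h; exact: PQ.
suff : G --> f by apply.
apply/cvg_sup => i U [V] [[W oW <-] Wf] VU.
have /seminorm_nbhsP[q [eps [e0 h]]] : nbhs (f i) W by apply: open_nbhs_nbhs.
by exists q, eps; split=> // g hg; apply: VU; apply: h; exact: hg.
Qed.

Lemma seminorm_complete (s : nat -> X) :
  (forall q (eps : R), 0 < eps -> exists n0, forall m n,
     (n0 <= m)%N -> (n0 <= n)%N -> seminorm q (s m - s n) < eps) ->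
  exists x, forall q (eps : R), 0 < eps -> exists n0, forall n,
     (n0 <= n)%N -> seminorm q (s n - x) < eps.
Proof.
move=> cs; have : cauchy (s @ \oo).
  move=> A /entourage_seminorm[q [eps [e0 hA]]].
  have [n0 h] := cs q _ e0.
  exists (s @` [set n | (n0 <= n)%N], s @` [set n | (n0 <= n)%N]).
    by split; exists n0 => // n hn /=; exists n.
  by move=> [a b] [/= [m hm <-] [n hn <-]]; apply: hA; exact: h.
move=> /frechet_complete[x sx]; exists x => q eps e0.
have /sx[n0 _ h] := @seminorm_ball_nbhs q x _ e0.
by exists n0.
Qed.

Lemma seminorm_cvgP (s : nat -> X) x : s @ \oo --> x <->
  forall q (eps : R), 0 < eps -> exists n0, forall n,
     (n0 <= n)%N -> seminorm q (s n - x) < eps.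
Proof.
split=> [sx q eps e0|h A /seminorm_nbhsP[q [eps [e0 hA]]]].
  by have /sx[n0 _ h] := @seminorm_ball_nbhs q x _ e0; exists n0.
by have [n0 hn] := h q _ e0; exists n0 => // n /hn; exact: hA.
Qed.

Lemma seminorm_geometric_complete (s : nat -> X) :
  (forall j, seminorm j (s j.+1 - s j) <= 2^-1 ^+ j) ->
  exists x, forall q (eps : R), 0 < eps -> exists n0, forall n,
     (n0 <= n)%N -> seminorm q (s n - x) < eps.
Proof.
move=> hs; apply: seminorm_complete => q eps e0.
have dist q' m n : (q' <= n <= m)%N ->
    seminorm q' (s m - s n) <= 2 * (2^-1 ^+ n - 2^-1 ^+ m).
  move=> /andP[qn] /subnK <-; elim: (m - n)%N => [|k IH].
    by rewrite add0n !subrr seminorm0 mulr0.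
  rewrite addSn; apply: le_trans (seminormB _ _ (s (k + n)%N) _) _.
  have h : seminorm q' (s (k + n).+1 - s (k + n)%N) <= 2^-1 ^+ (k + n).
    apply: le_trans (hs _); apply: seminorm_le.
    by rewrite (leq_trans qn) ?leq_addl.
  by rewrite exprS; lra.
have p2 (k : nat) : 0 < (2^-1 : R) ^+ k by rewrite exprn_gt0 // invr_gt0.
pose n0 := Num.bound (2 / eps).
have hn0 n : (n0 <= n)%N -> 2 * 2^-1 ^+ n < eps.
  move=> /upper_nthrootP; rewrite exprVn ltr_pdivrMr // => h.
  by rewrite ltr_pdivrMr ?exprn_gt0 // mulrC.
have half m n : (maxn q n0 <= n <= m)%N -> seminorm q (s m - s n) < eps.
  rewrite geq_max => /andP[/andP[qn n0n] nm].
  apply: le_lt_trans (dist q m n _) _; first by rewrite qn.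
  by have := hn0 n n0n; have := p2 m; lra.
exists (maxn q n0) => m n hm hn; have [nm|/ltnW mn] := leqP n m.
  by apply: half; rewrite hn.
by rewrite seminorm_distC; apply: half; rewrite hm.
Qed.

End Seminorms.

(** Some seminorm ball lies in the unit ball of the norm. It contains all multiples of a vector
    killed by that seminorm, which by homogeneity forces the norm of this vector to be 0. *)
Lemma continuous_norm_index (R : realType) (X : frechetSequenceAlgebraType R) :
  has_continuous_norm X ->
  exists q0, forall x : X, seminorm q0 x = 0 -> x = 0.
Proof.
move=> [N [[ND NZ N0] cN]].
have N00 : N 0 = 0.
  by rewrite -(scale0r (0 : X)) NZ ComplexField.Normc.normc0 mul0r.
have := cN 0 (ball (N 0) 1) (nbhsx_ballx _ _ ltr01).
move=> /seminorm_nbhsP[q0 [eps [e0 h]]]; exists q0 => x qx0.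
apply: N0; apply/eqP; rewrite -normr_le0; apply/ler_addgt0Pl => r r0.
rewrite addr0; have := h (r^-1%:C *: x).
rewrite subr0 seminormZ qx0 mulr0 => /(_ e0).
rewrite /= /ball /= N00 sub0r normrN NZ modulus_real normrM normr_id.
by rewrite (gtr0_norm (_ : 0 < r^-1)) ?invr_gt0// mulrC ltr_pdivrMr// mul1r =>
  /ltW.
Qed.

(** * Coordinates and partial sums along the basis *)

Section Basis.
Variables (R : realType) (X : frechetSequenceAlgebraType R) (e : nat -> X).
Hypothesis e_unit : unit_vectors e.
Implicit Types (x y z : X) (q : nat) (a b : nat -> R[i]).

Lemma seqcoord_partial_sum a n k :
  seqcoord (\sum_(0 <= j < n) a j *: e j) k = if (k < n)%N then a k else 0.
Proof.
rewrite seqcoord_sum; under eq_bigr do rewrite seqcoordZ e_unit.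
case: ltnP => kn.
  rewrite (bigD1_seq k) ?mem_index_iota ?iota_uniq//= eqxx mulr1 big1 ?addr0//.
  by move=> j jk; rewrite eq_sym (negbTE jk) mulr0.
rewrite big_nat_cond big1 // => j /andP[/andP[_ jn] _].
by rewrite gtn_eqF ?mulr0// (leq_trans jn).
Qed.

Lemma partial_sum_tail (P n : nat) a : (P <= n)%N ->
  \sum_(0 <= j < n) (if (P <= j)%N then a j else 0) *: e j =
  \sum_(0 <= j < n) a j *: e j - \sum_(0 <= j < P) a j *: e j.
Proof.
move=> Pn; rewrite (big_cat_nat (m := 0) (p := n) (n := P))//=.
rewrite (big_cat_nat (m := 0) (p := n) (n := P))//=.
rewrite [RHS]addrAC subrr add0r big_nat_cond big1 ?add0r; last first.
  by move=> j /andP[/andP[_ jP] _]; rewrite leqNgt jP scale0r.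
by apply: eq_big_nat => j /andP[-> _].
Qed.

Lemma seminorm_partial_sum_le q n a (r : R) :
  (forall j, (j < n)%N -> modulus (a j) <= r) ->
  seminorm q (\sum_(0 <= j < n) a j *: e j) <=
  r * \sum_(0 <= j < n) seminorm q (e j).
Proof.
move=> ar; apply: le_trans (seminorm_sum _ _ _ _) _; rewrite mulr_sumr.
rewrite big_nat_cond [leRHS]big_nat_cond;
  apply: ler_sum => j /andP[/andP[_ jn] _].
by rewrite seminormZ ler_wpM2r ?seminorm_ge0 ?ar.
Qed.

Variable q0 : nat.
Hypothesis norm_q0 : forall x, seminorm q0 x = 0 -> x = 0.

Lemma seminorm_unit_gt0 q k : (q0 <= q)%N -> 0 < seminorm q (e k).
Proof.
move=> q0q; apply: lt_le_trans (seminorm_le _ q0q).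
rewrite lt_def seminorm_ge0 andbT; apply/eqP => /norm_q0 ek0.
have := e_unit k k; rewrite ek0 seqcoord0 eqxx => /eqP.
by rewrite eq_sym oner_eq0.
Qed.

(* Multiplying by [e k] extracts the [k]-th coordinate, so submultiplicativity
   bounds it. *)
Lemma modulus_seqcoord_le q x k :
  (q0 <= q)%N -> modulus (seqcoord x k) <= seminorm q x.
Proof.
move=> q0q; have ek := seminorm_unit_gt0 k q0q.
have -> : modulus (seqcoord x k) =
    seminorm q (seqmul (e k) x) / seminorm q (e k).
  have -> : seqmul (e k) x = seqcoord x k *: e k.
    apply: seqcoord_ext => n; rewrite seqcoord_seqmul seqcoordZ e_unit.
    by case: eqP => [->|]; rewrite ?mul1r ?mulr1 ?mul0r ?mulr0.
  by rewrite seminormZ mulfK ?gt_eqF.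
by rewrite ler_pdivrMr// mulrC seminorm_seqmul.
Qed.

Hypothesis e_basis : unconditional_basis e.

(** The coefficients supplied by the Schauder basis are the coordinates: late partial sums have
    [k]-th coordinate [a k], and [seminorm q0] controls coordinates. *)
Lemma basis_series x : series (fun k => seqcoord x k *: e k) @ \oo --> x.
Proof.
have [a [ax _]] := e_basis.1 x.
suff -> : seqcoord x = a by [].
apply/funext => k; apply/eqP; rewrite -subr_eq0; apply/eqP.
apply: ComplexField.Normc.eq0_normc; apply/eqP; rewrite eq_le modulus_ge0 andbT.
apply/ler_addgt0Pl => r r0; rewrite addr0.
have [n0 h] := (seminorm_cvgP _ _).1 ax q0 r r0.
have := h (maxn n0 k.+1) (leq_maxl _ _).
rewrite seminorm_distC => /ltW; apply: le_trans.
have := @modulus_seqcoord_le q0 (x - series (fun k => a k *: e k) (maxn n0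
  k.+1)) k (leqnn _).
by rewrite seqcoordB /series/= seqcoord_partial_sum leq_max ltnSn orbT.
Qed.

Lemma basis_approx x q (eps : R) : 0 < eps -> exists n0, forall n, (n0 <=
  n)%N ->
  seminorm q (\sum_(0 <= k < n) seqcoord x k *: e k - x) < eps.
Proof. by have /seminorm_cvgP := @basis_series x; apply. Qed.

End Basis.

(** * Domination by coordinates *)

(* Inside each block [P j, P j.+1[ the elements of [J j] are listed first. *)
Lemma block_permutation (P : nat -> nat) (J : nat -> pred nat) :
  P 0 = 0%N -> (forall j, P j < P j.+1)%N ->
  exists s : nat -> nat, bijective s /\ forall j,
    exists h, [seq s k | k <- iota (P j) h] =
      [seq k <- iota (P j) (P j.+1 - P j) | J j k].
Proof.
move=> P0 Plt; have Ple : {homo P : m n / (m <= n)%N}.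
  by apply: homo_leq => //; [exact: leq_trans | move=> j; exact: ltnW].
have exb k : exists j, (P j <= k < P j.+1)%N.
  elim: k => [|k [j /andP[jk kj]]]; first by exists 0%N; have := Plt 0%N;
    rewrite P0.
  have [h|h] := ltnP k.+1 (P j.+1); first by exists j; rewrite h ltnW.
  exists j.+1; rewrite h /=; have -> : k.+1 = P j.+1 by apply/eqP;
    rewrite eqn_leq kj h.
  exact: Plt.
have [b bP] := choice exb.
have bE k j : (P j <= k < P j.+1)%N -> b k = j.
  move=> /andP[jk kj]; have /andP[bk kb] := bP k; apply/eqP; rewrite eqn_leq.
  apply/andP; split; rewrite leqNgt; apply/negP => h.
    by have := leq_trans kj (leq_trans (Ple _ _ h) bk); rewrite ltnn.
  by have := leq_trans kb (leq_trans (Ple _ _ h) jk); rewrite ltnn.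
pose I j := iota (P j) (P j.+1 - P j).
pose L j := seq.filter (J j) (I j) ++ seq.filter (predC (J j)) (I j).
have LI j : perm_eq (L j) (I j) by rewrite /L perm_filterC.
have memL j k : (k \in L j) = (P j <= k < P j.+1)%N.
  by rewrite (perm_mem (LI j)) mem_iota subnKC // ltnW.
have sL j : size (L j) = (P j.+1 - P j)%N by rewrite (perm_size (LI j))
  size_iota.
have uL j : uniq (L j) by rewrite (perm_uniq (LI j)) iota_uniq.
pose s k := nth 0%N (L (b k)) (k - P (b k)).
pose t k := (P (b k) + index k (L (b k)))%N.
have lts k : (k - P (b k) < size (L (b k)))%N.
  by rewrite sL; have /andP[h1 h2] := bP k;
    rewrite ltn_sub2r // (leq_ltn_trans h1).
have bs k : b (s k) = b k by apply: bE; rewrite -memL mem_nth.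
have bt k : b (t k) = b k.
  apply: bE; rewrite /t leq_addr /= -ltn_subRL -sL index_mem memL; exact: bP.
exists s; split.
  exists t => k; rewrite ?/t ?bs.
    by rewrite /s index_uniq // subnKC //; have /andP[] := bP k.
  by rewrite /s -/(t k) bt /t addKn nth_index // memL; exact: bP.
move=> j; exists (size (seq.filter (J j) (I j))).
apply: (@eq_from_nth _ 0%N); first by rewrite size_map size_iota.
move=> i; rewrite size_map size_iota => ih.
rewrite (nth_map 0%N) ?size_iota // nth_iota // /s.
have -> : b (P j + i)%N = j.
  apply: bE; rewrite leq_addr /= -ltn_subRL -sL /L size_cat.
  by apply: leq_trans ih _; rewrite leq_addr.
by rewrite addKn /L nth_cat ih.
Qed.

Section Unconditional.
Variables (R : realType) (X : frechetSequenceAlgebraType R) (e : nat -> X).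
Implicit Types (x y z : X) (q : nat) (a b : nat -> R[i]).

(** A seminorm is convex, so over the cube of coefficients it is largest at a vertex, that is, at a
    subsum. The offset [z] lets the induction absorb the last term. *)
Lemma seminorm_convex_sum q (v : nat -> X) (t : nat -> R) n z (B : R) :
  (forall k, 0 <= t k <= 1) ->
  (forall J : pred nat, seminorm q (z + \sum_(0 <= k < n | J k) v k) <= B) ->
  seminorm q (z + \sum_(0 <= k < n) (t k)%:C *: v k) <= B.
Proof.
move=> t01; elim: n z => [|n IH] z hB.
  by have := hB xpredT; rewrite !big_nil.
rewrite big_nat_recr //=; set S := \sum_(0 <= k < n) _.
have -> : z + (S + (t n)%:C *: v n) =
    (t n)%:C *: ((z + v n) + S) + (1 - t n)%:C *: (z + S).
  rewrite addrAC [(t n)%:C *: (z + S + v n)]scalerDr addrAC -scalerDl.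
  have -> : (t n)%:C + (1 - t n)%:C = 1 :> R[i] by rewrite -rmorphD subrKC
    rmorph1.
  by rewrite scale1r -addrA.
have /andP[t0 t1] := t01 n.
apply: le_trans (seminorm_triangle _ _ _) _; rewrite !seminormZ !modulus_real.
rewrite ger0_norm // ger0_norm ?subr_ge0 //.
have h1 : seminorm q (z + v n + S) <= B.
  apply: IH => J; have := hB (fun k => (k == n) || J k).
  have -> : \sum_(0 <= k < n.+1 | (k == n) || J k) v k =
      v n + \sum_(0 <= k < n | J k) v k.
    rewrite big_mkcond big_nat_recr //= eqxx addrC [in RHS]big_mkcond.
    by congr (_ + _); apply: eq_big_nat => k /andP[_ kn]; rewrite ltn_eqF.
  by rewrite addrA.
have h2 : seminorm q (z + S) <= B.
  apply: IH => J; have := hB (fun k => (k != n) && J k).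
  have -> // : \sum_(0 <= k < n.+1 | (k != n) && J k) v k =
      \sum_(0 <= k < n | J k) v k.
  rewrite big_mkcond big_nat_recr //= eqxx addr0 [in RHS]big_mkcond.
  by apply: eq_big_nat => k /andP[_ kn]; rewrite ltn_eqF.
have -> : B = t n * B + (1 - t n) * B by ring.
by apply: lerD; apply: ler_wpM2l => //; rewrite subr_ge0.
Qed.

Hypothesis e_basis : unconditional_basis e.

(* Otherwise, a permutation bringing together the indices of bad finite sets
   would destroy the convergence of the series. *)
Lemma unconditional_subsum x a q (eta : R) :
  series (fun k => a k *: e k) @ \oo --> x -> 0 < eta ->
  exists n0, forall n (J : pred nat), (forall k, J k -> (n0 <= k)%N) ->
    seminorm q (\sum_(0 <= k < n | J k) a k *: e k) <= eta.
Proof.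
move=> ax eta0; apply: contrapT => /forallNP H.
have {}H n0 : exists nJ : nat * pred nat, (forall k, nJ.2 k -> (n0 <= k)%N) /\
    eta < seminorm q (\sum_(0 <= k < nJ.1 | nJ.2 k) a k *: e k).
  have := H n0 => /existsNP[n /existsNP[J /not_implyP[J0 /negP]]].
  by rewrite -ltNge => h; exists (n, J).
have [g gP] := choice H.
(* The block starting at [P j] is long enough to contain the bad finite set found beyond [P j]. *)
pose P := fix P j := if j is j'.+1 then maxn (g (P j')).1 (P j').+1 else 0%N.
have [] := @block_permutation P (fun j k => (g (P j)).2 k && (k <
  (g (P j)).1)%N).
- by [].
- by move=> j /=; rewrite leq_max ltnSn orbT.
move=> s [bs hs]; have [_ /(_ _ _ ax _ bs)] := e_basis.
have e20 : 0 < eta / 2 by rewrite divr_gt0.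
move=> /seminorm_cvgP/(_ q _ e20) [n0 hn0].
have Pj j : (j <= P j)%N.
  by elim: j => //= j IH; apply: leq_trans (leq_maxr _ _); rewrite ltnS.
have [h hh] := hs n0.
have := hn0 (P n0 + h)%N (leq_trans (Pj n0) (leq_addr _ _)).
have := hn0 (P n0) (Pj n0); rewrite seminorm_distC => h1 h2.
have [_] := gP (P n0); rewrite ltNge => /negP; apply.
(* The bad sum is a difference of two partial sums of the rearranged series, both within [eta / 2]
   of [x]. *)
suff -> : \sum_(0 <= k < (g (P n0)).1 | (g (P n0)).2 k) a k *: e k =
    series (fun k => a (s k) *: e (s k)) (P n0 + h)%N -
    series (fun k => a (s k) *: e (s k)) (P n0).
  by apply: le_trans (seminormB _ _ x _) _; move: h1 h2; lra.
rewrite /series /= (big_cat_nat (m := 0) (p := (P n0 + h)%N) (n :=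
  P n0)) ?leq_addr //=.
rewrite [RHS]addrAC subrr add0r.
have -> : \sum_(P n0 <= k < P n0 + h) a (s k) *: e (s k) =
    \sum_(k <- [seq s k | k <- iota (P n0) h]) a k *: e k.
  by rewrite big_map /index_iota addKn.
rewrite hh big_filter; have [J0 _] := gP (P n0).
rewrite -[X in _ = \sum_(_ <- X | _) _]/(index_iota (P n0) (P n0.+1)).
transitivity (\sum_(0 <= k < P n0.+1 | (g (P n0)).2 k && (k <
  (g (P n0)).1)%N) a k *: e k).
  rewrite (big_cat_nat (m := 0) (p := P n0.+1) (n :=
    (g (P n0)).1)) ?leq_maxl //=.
  rewrite [X in _ + X]big_nat_cond [X in _ + X]big1 ?addr0.
    rewrite big_nat_cond [RHS]big_nat_cond; apply: eq_bigl => k.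
    by case: ltnP; rewrite ?andbF ?andbT.
  by move=> k /andP[/andP[kg _] /andP[_]]; rewrite ltnNge kg.
rewrite (big_cat_nat (m := 0) (p := P n0.+1) (n := P n0)) //=; last first.
  by apply: leq_trans (leq_maxr _ _).
rewrite big_nat_cond big1 ?add0r //.
by move=> k /andP[/andP[_ kP] /andP[/J0]]; rewrite leqNgt kP.
Qed.

(** The ratio [b k / a k] lies in the unit disc. The positive and negative parts of its real and
    imaginary parts are four numbers in [0, 1], and by convexity each of the four resulting sums is
    at most [eta / 4]. *)
Lemma unconditional_dominated x a q (eta : R) :
  series (fun k => a k *: e k) @ \oo --> x -> 0 < eta ->
  exists n0, forall n b, (forall k, (k < n0)%N -> b k = 0) ->
    (forall k, modulus (b k) <= modulus (a k)) ->
    seminorm q (\sum_(0 <= k < n) b k *: e k) <= eta.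
Proof.
move=> ax eta0; have e40 : 0 < eta / 4 by rewrite divr_gt0.
have [n0 hn0] := unconditional_subsum q ax e40; exists n0 => n b b0 ba.
pose v k := if (n0 <= k)%N then a k *: e k else 0.
have hv (t : nat -> R) : (forall k, 0 <= t k <= 1) ->
    seminorm q (\sum_(0 <= k < n) (t k)%:C *: v k) <= eta / 4.
  move=> t01; rewrite -[X in seminorm q X]add0r;
    apply: seminorm_convex_sum => // J.
  rewrite add0r -big_mkcondr; apply: hn0 => k /andP[_ //].
have part k : exists r : (R * R) * (R * R), [/\ 0 <= r.1.1 <= 1, 0 <= r.1.2 <=
  1,
    0 <= r.2.1 <= 1, 0 <= r.2.2 <= 1 &
    b k *: e k = r.1.1%:C *: v k - r.1.2%:C *: v k +
      (0 +i* 1) *: (r.2.1%:C *: v k - r.2.2%:C *: v k)].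
  have [kn0|n0k] := ltnP k n0.
    exists ((0, 0), (0, 0)); rewrite /= lexx ler01; split=> //.
    by rewrite /v leqNgt kn0 /= b0 // !scaler0 scale0r subrr add0r scaler0.
  have [ak0|ak0] := eqVneq (a k) 0.
    have bk0 : b k = 0.
      apply: ComplexField.Normc.eq0_normc; apply/eqP;
        rewrite eq_le modulus_ge0 andbT.
      by apply: le_trans (ba k) _; rewrite ak0 ComplexField.Normc.normc0.
    exists ((0, 0), (0, 0)); rewrite /= lexx ler01; split=> //.
    by rewrite bk0 !scale0r subrr scaler0 addr0.
  have h : modulus (b k / a k) <= 1.
    rewrite ComplexField.Normc.normcM ComplexField.Normc.normcV ler_pdivrMr
      ?mul1r //.
    rewrite lt_def modulus_ge0 andbT; apply/eqP =>
      /ComplexField.Normc.eq0_normc/eqP.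
    by rewrite (negbTE ak0).
  case def_c : (b k / a k) h => [x1 y1] h.
  have h1 : x1 ^+ 2 + y1 ^+ 2 <= 1 by rewrite -(ler_sqrt _ ler01) sqrtr1.
  exists ((Num.max x1 0, Num.max (- x1) 0), (Num.max y1 0, Num.max (- y1) 0)).
  have hm (r : R) : r ^+ 2 <= 1 -> 0 <= Num.max r 0 <= 1.
    by move=> r1; case: (leP r 0) => r0; apply/andP; split; nra.
  have mE (r : R) : Num.max r 0 - Num.max (- r) 0 = r.
    by case: (leP r 0) => r0; case: (leP (- r) 0) => r1; lra.
  split=> /=; try (by apply: hm; rewrite ?sqrrN; nra).
  rewrite -!scalerBl scalerA -scalerDl -!rmorphB !mE /v n0k.
  rewrite -(divfK ak0 (b k)) def_c -scalerA; congr (_ *: _).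
  by simpc.
have [r hr] := choice part.
have -> : \sum_(0 <= k < n) b k *: e k =
    \sum_(0 <= k < n) ((r k).1.1%:C *: v k - (r k).1.2%:C *: v k +
      (0 +i* 1) *: ((r k).2.1%:C *: v k - (r k).2.2%:C *: v k)).
  by apply: eq_bigr => k _; have [] := hr k.
rewrite big_split /= sumrB -scaler_sumr sumrB.
have h1 := hv (fun k => (r k).1.1) (fun k => ltac:(by have [] := hr k)).
have h2 := hv (fun k => (r k).1.2) (fun k => ltac:(by have [] := hr k)).
have h3 := hv (fun k => (r k).2.1) (fun k => ltac:(by have [] := hr k)).
have h4 := hv (fun k => (r k).2.2) (fun k => ltac:(by have [] := hr k)).
apply: le_trans (seminorm_triangle _ _ _) _;
  rewrite seminormZ /= expr0n expr1n add0r.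
rewrite sqrtr1 mul1r.
have := seminorm_triangle q (\sum_(0 <= k <
  n) (r k).1.1%:C *: v k) (- \sum_(0 <= k < n) (r k).1.2%:C *: v k).
have := seminorm_triangle q (\sum_(0 <= k <
  n) (r k).2.1%:C *: v k) (- \sum_(0 <= k < n) (r k).2.2%:C *: v k).
rewrite !seminormN; move: h1 h2 h3 h4; lra.
Qed.

End Unconditional.

Section Domination.
Variables (R : realType) (X : frechetSequenceAlgebraType R) (e : nat -> X).
Variable q0 : nat.
Hypothesis e_unit : unit_vectors e.
Hypothesis norm_q0 : forall x : X, seminorm q0 x = 0 -> x = 0.
Hypothesis e_basis : unconditional_basis e.
Implicit Types (x y z : X) (q : nat) (a b : nat -> R[i]).

Local Notation S a n := (\sum_(0 <= k < n) a k *: e k).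

Lemma partial_sum_truncate a n m : (n <= m)%N ->
  S (fun k => if (k < n)%N then a k else 0) m = S a n.
Proof.
move=> nm; apply: seqcoord_ext => k; rewrite !seqcoord_partial_sum //.
by case: (ltnP k n) => kn; [rewrite (leq_trans kn nm) | case: ifP].
Qed.

Let bad q (eta : R) Q (delta : R) P (u : nat * ((nat -> R[i]) * (nat ->
  R[i]))) :=
  [/\ forall k, modulus (u.2.1 k) <= modulus (u.2.2 k),
      forall k, (k < P)%N || (u.1 <= k)%N -> u.2.1 k = 0 /\ u.2.2 k = 0,
      seminorm Q (S u.2.2 u.1) < delta & eta <= seminorm q (S u.2.1 u.1)].

(** Cuts the first [P] coefficients off a counterexample. Smallness of the majorant in an index at
    least [q0] bounds each coefficient by [dd], so the discarded heads cost at most [dd * K]; [dd]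
    is chosen so that the majorant stays below [delta] and at least half of [eta] survives. *)
Let bad_tail q (eta : R) : 0 < eta ->
  (forall Q (delta : R), 0 < delta -> exists n a b,
     [/\ forall k, modulus (a k) <= modulus (b k),
         seminorm Q (S b n) < delta & eta <= seminorm q (S a n)]) ->
  forall P Q (delta : R), 0 < delta -> exists u, bad q (eta / 2) Q delta P u.
Proof.
move=> eta0 H P Q delta d0.
pose K := \sum_(0 <= j < P) seminorm Q (e j) + \sum_(0 <= j <
  P) seminorm q (e j).
have KQ0 : 0 <= \sum_(0 <= j < P) seminorm Q (e j) by apply: sumr_ge0 => j _;
  exact: seminorm_ge0.
have Kq0 : 0 <= \sum_(0 <= j < P) seminorm q (e j) by apply: sumr_ge0 => j _;
  exact: seminorm_ge0.
pose dd := Num.min delta (eta / 2) / (K + 2).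
have K2 : 0 < K + 2 by rewrite /K; lra.
have m0 : 0 < Num.min delta (eta / 2) by rewrite lt_min d0 divr_gt0.
have dd0 : 0 < dd by rewrite divr_gt0.
have ddE : dd * (K + 2) = Num.min delta (eta / 2) by rewrite /dd divfK //
  gt_eqF.
have dd1 : dd * (K + 2) <= delta by rewrite ddE ge_min lexx.
have dd2 : dd * (K + 2) <= eta / 2 by rewrite ddE ge_min lexx orbT.
have [n [a [b [ab hb ha]]]] := H (maxn Q q0) dd dd0.
have bdd j : (j < n)%N -> modulus (b j) <= dd.
  move=> jn; apply: ltW; apply: le_lt_trans hb.
  have := @modulus_seqcoord_le _ _ _ e_unit _ norm_q0 (maxn Q q0) (S b n) j
    (leq_maxr _ _).
  by rewrite seqcoord_partial_sum // jn.
pose trunc c k : R[i] := if (k < n)%N then c k else 0.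
pose tail c k : R[i] := if (P <= k)%N then trunc c k else 0.
have nP : (n <= maxn n P)%N by rewrite leq_maxl.
have tailE c : S (tail c) (maxn n P) = S c n - S (trunc c) P.
  by rewrite partial_sum_tail ?leq_maxr // partial_sum_truncate.
have ltrunc c : (forall j, (j < n)%N -> modulus (c j) <= dd) ->
    forall j, (j < P)%N -> modulus (trunc c j) <= dd.
  move=> cd j _; rewrite /trunc; case: ifP => [/cd //|_].
  by rewrite ComplexField.Normc.normc0 ltW.
exists (maxn n P, (tail a, tail b)); split => /=.
- by move=> k; rewrite /tail /trunc; case: ifP => _ //; case: ifP.
- move=> k /orP[kP|nk]; rewrite /tail /trunc; first by rewrite leqNgt kP.
  by rewrite ltnNge (leq_trans nP nk) /=; case: ifP.
- rewrite tailE; apply: le_lt_trans (seminorm_triangle _ _ _) _;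
    rewrite seminormN.
  have := seminorm_partial_sum_le e Q (ltrunc b bdd).
  have : seminorm Q (S b n) < dd by apply: le_lt_trans hb;
    exact: seminorm_le (leq_maxl _ _).
  have : 0 <= dd * (\sum_(0 <= j < P) seminorm q (e j)) by rewrite mulr_ge0 //
    ltW.
  move: dd1; rewrite /K; set s1 := \sum_(_ <= j < _) _; set s2 := \sum_(_ <=
    j < _) _; lra.
- have := seminorm_partial_sum_le e q (ltrunc a (fun j jn => le_trans (ab j)
    (bdd j jn))).
  have : seminorm q (S a n) <= seminorm q (S (tail a) (maxn n P)) +
    seminorm q (S (trunc a) P).
    by rewrite tailE -[X in seminorm q X <= _](subrK (S (trunc a) P))
      seminorm_triangle.
  have : 0 <= dd * (\sum_(0 <= j < P) seminorm Q (e j)) by rewrite mulr_ge0 //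
    ltW.
  move: dd2 ha; rewrite /K; set s1 := \sum_(_ <= j < _) _; set s2 := \sum_(_ <=
    j < _) _; lra.
Qed.

(* Gliding hump: if the claim fails, it fails on arbitrarily remote blocks, and
   summing such blocks gives an element of [X] contradicting
   [unconditional_dominated]. *)
Let partial_sum_domination q (eta : R) : 0 < eta ->
  exists Q (delta : R), 0 < delta /\ forall n a b,
    (forall k, modulus (a k) <= modulus (b k)) ->
    seminorm Q (S b n) < delta -> seminorm q (S a n) < eta.
Proof.
move=> eta0; apply: contrapT => H.
have {}H Q (delta : R) : 0 < delta -> exists n a b,
     [/\ forall k, modulus (a k) <= modulus (b k),
         seminorm Q (S b n) < delta & eta <= seminorm q (S a n)].
  move=> d0; apply: contrapT => H1; apply: H; exists Q, delta;
    split=> // n a b ab hb.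
  by rewrite ltNge; apply/negP => ha; apply: H1; exists n, a, b.
have p2 (k : nat) : 0 < (2^-1 : R) ^+ k by rewrite exprn_gt0 // invr_gt0.
have /choice[g gP] : forall Pj : nat * nat, exists u,
    bad q (eta / 2) Pj.2 (2^-1 ^+ Pj.2) Pj.1 u.
  by move=> [P j]; apply: bad_tail.
(* Each hump starts beyond the end of the previous one, so their supports are disjoint; the [j]-th
   majorant has [j]-th seminorm below [2^-j], so the majorants sum to a vector [x]. *)
pose P := fix P j := if j is j'.+1 then maxn (g (P j',
  j')).1 (P j').+1 else 0%N.
pose G j := g (P j, j).
have GP j : bad q (eta / 2) j (2^-1 ^+ j) (P j) (G j) by exact: (gP (P j, j)).
pose x_ j := S (G j).2.2 (G j).1.
have x_E j k : seqcoord (x_ j) k = (G j).2.2 k.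
  rewrite /x_ seqcoord_partial_sum //; case: ltnP => // h.
  by have [_ /(_ k)] := GP j; rewrite h orbT => /(_ isT)[_ ->].
have [|x hx] := @seminorm_geometric_complete _ X (fun J => \sum_(0 <= j <
  J) x_ j).
  by move=> j; rewrite big_nat_recr //= addrAC subrr add0r; have [_ _ /ltW] :=
    GP j.
have Plt j : (P j < P j.+1)%N by rewrite /= leq_max ltnSn orbT.
have Ple : {homo P : m n / (m <= n)%N}.
  by apply: homo_leq => //; [exact: leq_trans | move=> j; exact: ltnW].
have Pj j : (j <= P j)%N by elim: j => // j IH; apply: leq_ltn_trans (Plt j).
have xE j k : (P j <= k < (G j).1)%N -> seqcoord x k = (G j).2.2 k.
  move=> /andP[Pk kG]; apply/eqP; rewrite -subr_eq0; apply/eqP.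
  apply: ComplexField.Normc.eq0_normc; apply/eqP;
    rewrite eq_le modulus_ge0 andbT.
  apply/ler_addgt0Pl => r r0; rewrite addr0.
  have [n0 /(_ (maxn n0 j.+1) (leq_maxl _ _))] := hx q0 r r0.
  rewrite seminorm_distC => /ltW; apply: le_trans.
  have := @modulus_seqcoord_le _ _ _ e_unit _ norm_q0 q0
    (x - \sum_(0 <= j < maxn n0 j.+1) x_ j) k (leqnn _).
  rewrite seqcoordB seqcoord_sum (bigD1_seq j) ?mem_index_iota ?iota_uniq //=;
    last first.
    by rewrite leq_max ltnSn orbT.
  rewrite x_E big1 ?addr0 // => i ij; rewrite x_E.
  have [_ /(_ k) h _ _] := GP i; apply: (fun h' => (h h').2).
  have [ji|ji|E] := ltngtP i j; last by rewrite E eqxx in ij.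
    apply/orP; right; apply: leq_trans Pk; apply: leq_trans (Ple _ _ ji).
    by rewrite /= leq_maxl.
  by rewrite (leq_trans _ (Ple _ _ ji)) //; apply: leq_trans kG _;
    rewrite /= leq_maxl.
have e80 : 0 < eta / 4 by rewrite divr_gt0.
have [n0 hn0] := unconditional_dominated e_basis q
  (@basis_series _ _ _ e_unit _ norm_q0 e_basis x) e80.
(* On the [n0]-th hump the majorant is the coordinate sequence of [x], so the upper bound [eta / 4]
   contradicts the lower bound [eta / 2]. *)
have [ab a0 _ ha] := GP n0.
have : seminorm q (S (G n0).2.1 (G n0).1) <= eta / 4.
  apply: hn0 => [k kn|k]; first by apply: (a0 k _).1; rewrite (leq_trans kn).
  have [kP|Pk] := ltnP k (P n0); first by rewrite (a0 k _).1 ?kP //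
    ComplexField.Normc.normc0 modulus_ge0.
  have [kG|Gk] := ltnP k (G n0).1; first by rewrite (xE n0) ?Pk.
  by rewrite (a0 k _).1 ?Gk ?orbT // ComplexField.Normc.normc0 modulus_ge0.
by move: ha; lra.
Qed.

(** Passes from finite sums to vectors by comparing far partial sums of [z] and of a multiple of
    [x]. The factor [K = |M| + 1] absorbs [M] and is positive whatever the sign of [M]. *)
Lemma domination q (eta M : R) : 0 < eta ->
  exists Q (delta : R), 0 < delta /\ forall z x,
    (forall k, modulus (seqcoord z k) <= M * modulus (seqcoord x k)) ->
    seminorm Q x < delta -> seminorm q z < eta.
Proof.
move=> eta0; have e20 : 0 < eta / 2 by rewrite divr_gt0.
have [Q [delta [d0 h]]] := partial_sum_domination q e20.
pose K := `|M| + 1; have K0 : 0 < K by rewrite /K ltr_wpDl.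
exists Q, (delta / K); split; first by rewrite divr_gt0.
move=> z x zx xd.
have : 0 < delta - seminorm Q (K%:C *: x).
  by rewrite seminormZ modulus_real gtr0_norm // subr_gt0 mulrC -ltr_pdivlMr.
move=> /(basis_approx e_unit norm_q0 e_basis (K%:C *: x) Q)[n1 hn1].
have [n2 hn2] := basis_approx e_unit norm_q0 e_basis z q e20.
have h1 := hn1 (maxn n1 n2) (leq_maxl _ _).
have h2 := hn2 (maxn n1 n2) (leq_maxr _ _).
have h3 : seminorm q (S (seqcoord z) (maxn n1 n2)) < eta / 2.
  apply: (h _ _ (seqcoord (K%:C *: x))) => [k|].
    rewrite seqcoordZ ComplexField.Normc.normcM modulus_real gtr0_norm //.
    apply: le_trans (zx k) _; rewrite ler_wpM2r ?modulus_ge0 // /K.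
    by have := ler_norm M; lra.
  have := seminorm_triangle Q (S (seqcoord (K%:C *: x)) (maxn n1 n2) - K%:C *:
    x) (K%:C *: x).
  by rewrite subrK; move: h1; lra.
have := seminorm_triangle q (- (S (seqcoord z) (maxn n1 n2) - z)) (S (seqcoord
  z) (maxn n1 n2)).
by rewrite seminormN opprB subrK; move: h2 h3; lra.
Qed.

End Domination.

(** * Weighted shifts *)

Section Shifts.
Variables (R : realType) (X : frechetSequenceAlgebraType R).
Implicit Types (x y z : X) (q : nat) (w : nat -> R).

Definition seqpow x m : X := iterop m seqmul x 0.

Lemma seqpowS x m : seqpow x m.+2 = seqmul x (seqpow x m.+1).
Proof. by rewrite /seqpow !iteropS iterS. Qed.

Lemma seqcoord_seqpow x m k : (1 <= m)%N ->
  seqcoord (seqpow x m) k = seqcoord x k ^+ m.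
Proof.
case: m => // m _; elim: m => [|m IH]; first by rewrite expr1.
by rewrite seqpowS seqcoord_seqmul IH [RHS]exprS.
Qed.

Lemma pow_prodE d (u : 'I_d -> X) m i : pow_prod u m i = seqpow (u i) m.
Proof.
case: m => // m; rewrite /pow_prod /seqpow !iteropS.
by elim: m => //= m IH; rewrite [LHS]/mul_prod IH.
Qed.

Lemma seqmulBr x y z : seqmul x (y - z) = seqmul x y - seqmul x z.
Proof.
by apply: seqcoord_ext => n; rewrite seqcoordB !seqcoord_seqmul seqcoordB
  mulrBr.
Qed.

Lemma seqmulBl x y z : seqmul (x - y) z = seqmul x z - seqmul y z.
Proof.
by apply: seqcoord_ext => n; rewrite seqcoordB !seqcoord_seqmul seqcoordB
  mulrBl.
Qed.

(** By submultiplicativity the same index [q] serves on both sides: split [y^(m+2) - x^(m+2)] as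
    [y (y^(m+1) - x^(m+1)) + (y - x) x^(m+1)]. *)
Lemma seqpow_continuous x m q (eta : R) : (1 <= m)%N -> 0 < eta ->
  exists delta, 0 < delta /\ forall y, seminorm q (y - x) < delta ->
    seminorm q (seqpow y m - seqpow x m) < eta.
Proof.
case: m => // m _; elim: m eta => [|m IH] eta eta0; first by exists eta.
pose A := seminorm q x + 1; pose B := seminorm q (seqpow x m.+1) + 1.
have A0 : 0 < A by rewrite ltr_wpDl ?seminorm_ge0.
have B0 : 0 < B by rewrite ltr_wpDl ?seminorm_ge0.
have [|d1 [d10 h1]] := IH (eta / 2 / A); first by rewrite !divr_gt0.
exists (Num.min (Num.min d1 1) (eta / 2 / B)); split.
  by rewrite !lt_min d10 ltr01 !divr_gt0.
move=> y; rewrite !lt_min => /andP[/andP[yd1 y1] yB].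
have -> : seqpow y m.+2 - seqpow x m.+2 =
    seqmul y (seqpow y m.+1 - seqpow x m.+1) + seqmul (y - x) (seqpow x m.+1).
  by rewrite !seqpowS seqmulBr seqmulBl addrA subrK.
apply: le_lt_trans (seminorm_triangle _ _ _) _.
have hy : seminorm q y <= A.
  by have := seminorm_triangle q (y - x) x; rewrite subrK /A; lra.
have h2 : seminorm q (seqmul y (seqpow y m.+1 - seqpow x m.+1)) <= eta / 2.
  apply: le_trans (seminorm_seqmul _ _ _) _.
  apply: le_trans (_ : A * (eta / 2 / A) <= _);
    last by rewrite mulrC divfK ?gt_eqF.
  by apply: ler_pM; rewrite ?seminorm_ge0 // ltW // h1.
have h3 : seminorm q (seqmul (y - x) (seqpow x m.+1)) < eta / 2.
  apply: le_lt_trans (seminorm_seqmul _ _ _) _.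
  apply: le_lt_trans (_ : seminorm q (y - x) * B < _).
    by rewrite ler_wpM2l ?seminorm_ge0 // /B lerDl.
  by rewrite -ltr_pdivlMr.
lra.
Qed.

Section OneShift.
Variable w : nat -> R.
Hypothesis w_adm : admissible X w.

Lemma prod_weight_gt0 l n : 0 < \prod_(l.+1 <= v < n) w v.
Proof.
rewrite big_nat_cond; apply: prodr_gt0 => v /andP[/andP[lv _] _].
by have [h _ _] := w_adm; apply: h; apply: leq_trans lv.
Qed.

Lemma seqcoord_wshift x n :
  seqcoord (wshift w x) n = (w n.+1)%:C * seqcoord x n.+1.
Proof.
have [_ hw _] := w_adm; have [y xy] := hw x.
by have /(_ n) : is_shift w x (wshift w x) by apply: (xgetPex 0); exists y.
Qed.

Lemma seqcoord_iter_wshift n x l :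
  seqcoord (iter n (wshift w) x) l =
  (\prod_(l.+1 <= v < (n + l).+1) w v)%:C * seqcoord x (n + l)%N.
Proof.
elim: n l => [|n IH] l; first by rewrite add0n big_geq // rmorph1 mul1r.
rewrite iterS seqcoord_wshift IH mulrA -rmorphM addnS addSn.
by congr (_%:C * _); rewrite [RHS]big_ltn // !ltnS leq_addl.
Qed.

Lemma iter_wshiftB n x y :
  iter n (wshift w) (x - y) = iter n (wshift w) x - iter n (wshift w) y.
Proof.
apply: seqcoord_ext => k.
by rewrite seqcoordB !seqcoord_iter_wshift seqcoordB mulrBr.
Qed.

Lemma iter_wshiftD n x y :
  iter n (wshift w) (x + y) = iter n (wshift w) x + iter n (wshift w) y.
Proof.
apply: seqcoord_ext => k.
by rewrite seqcoordD !seqcoord_iter_wshift seqcoordD mulrDr.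
Qed.

Lemma iter_wshiftZ n (a : R[i]) x :
  iter n (wshift w) (a *: x) = a *: iter n (wshift w) x.
Proof.
apply: seqcoord_ext => k.
by rewrite seqcoordZ !seqcoord_iter_wshift seqcoordZ mulrCA.
Qed.

Lemma iter_wshift0 n : iter n (wshift w) (0 : X) = 0.
Proof. by rewrite -[in LHS](subrr 0) iter_wshiftB subrr. Qed.

Lemma iter_wshift_sum n (J : Type) (r : seq J) (P : pred J) (f : J -> X) :
  iter n (wshift w) (\sum_(j <- r | P j) f j) =
  \sum_(j <- r | P j) iter n (wshift w) (f j).
Proof.
by elim/big_rec2: _ => [|j y x _ h]; rewrite ?iter_wshift0 // iter_wshiftD h.
Qed.

Lemma iter_wshift_small n q (eta : R) : 0 < eta ->
  exists Q (delta : R), 0 < delta /\ forall x, seminorm Q x < delta ->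
    seminorm q (iter n (wshift w) x) < eta.
Proof.
elim: n q eta => [|n IH] q eta eta0; first by exists q, eta.
have [_ _ cw] := w_adm.
have /seminorm_nbhsP[Q [delta [d0 hd]]] :=
  cw 0 _ (@seminorm_ball_nbhs _ _ q (wshift w 0) _ eta0).
have [Q' [delta' [d'0 hd']]] := IH Q delta d0.
exists Q', delta'; split=> // x /hd' hx; rewrite iterS.
have := hd (iter n (wshift w) x); rewrite subr0 => /(_ hx) /=.
by have := iter_wshift0 1; rewrite /= => ->; rewrite subr0.
Qed.

Lemma iter_wshift_small_upto p q (eta : R) : 0 < eta ->
  exists Q (delta : R), 0 < delta /\ forall x, seminorm Q x < delta ->
    forall j, (j <= p)%N -> seminorm q (iter j (wshift w) x) < eta.
Proof.
move=> eta0; elim: p => [|p [Q [delta [d0 h]]]].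
  by exists q, eta; split=> // x hx [|].
have [Q' [delta' [d'0 h']]] := iter_wshift_small p.+1 q eta0.
exists (maxn Q Q'), (Num.min delta delta'); split; first by rewrite lt_min d0.
move=> x; rewrite lt_min => /andP[hx h'x] j;
  rewrite leq_eqVlt => /orP[/eqP ->|jp].
  by apply: h'; apply: le_lt_trans h'x; exact/seminorm_le/leq_maxr.
by apply: h => //; apply: le_lt_trans hx; exact/seminorm_le/leq_maxl.
Qed.

End OneShift.

Section ProductShift.
Variables (d : nat) (w : R -> nat -> R).

Lemma iter_wshift_prod n (lam : 'I_d -> R) (v : 'I_d -> X) i :
  iter n (wshift_prod w lam) v i = iter n (wshift (w (lam i))) (v i).
Proof. by elim: n => // n IH; rewrite iterS [LHS]/wshift_prod IH. Qed.

Lemma hypercyclic_hit (T : ('I_d -> X) -> 'I_d -> X) v :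
  hypercyclic T v -> forall (y : 'I_d -> X) q (eps : R), 0 < eps ->
  exists n, (1 <= n)%N /\ forall i, seminorm q (iter n T v i - y i) < eps.
Proof.
move=> hv y q eps e0.
have ny : nbhs y [set g : 'I_d -> X | forall i, seminorm q (g i - y i) < eps].
  by apply/prod_nbhsP; exists q, eps.
have [|| z [zO [n /= n1 nz]]] := hv (interior [set g : 'I_d -> X | forall i,
  seminorm q (g i - y i) < eps]).
- by exists y; exact: ny.
- exact: open_interior.
by exists n; split=> //; rewrite nz; exact: interior_subset zO.
Qed.

Lemma hit_hypercyclic (T : ('I_d -> X) -> 'I_d -> X) v :
  (forall (y : 'I_d -> X) q (eps : R), 0 < eps ->
    exists n, (1 <= n)%N /\ forall i, seminorm q (iter n T v i - y i) < eps) ->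
  hypercyclic T v.
Proof.
move=> hv O [y Oy] oO; have /prod_nbhsP[q [eps [e0 h]]] : nbhs y O.
  exact: open_nbhs_nbhs.
have [n [n1 hn]] := hv y q eps e0; exists (iter n T v); split; last by exists n.
exact: h.
Qed.

Variables (I : set R) (Lam : set ('I_d -> R)).
Hypothesis w_cont : continuous_family X I Lam w.

Lemma iter_wshift_prod_continuous n lam0 (u0 : 'I_d -> X) q (eta : R) :
  Lam lam0 -> 0 < eta ->
  exists (U : set ('I_d -> R)) Q (delta : R), [/\ nbhs lam0 U, 0 < delta &
    forall lam u, U lam -> Lam lam ->
      (forall i, seminorm Q (u i - u0 i) < delta) ->
      forall i, seminorm q (iter n (wshift_prod w lam) u i -
                            iter n (wshift_prod w lam0) u0 i) < eta].
Proof.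
move=> L0; elim: n q eta => [|n IH] q eta eta0.
  by exists setT, q, eta; split=> //; exact: filterT.
have [_ /subspace_continuousP cw] := w_cont.
have := cw (lam0, iter n (wshift_prod w lam0) u0) (conj L0 Logic.I).
pose B := [set g : 'I_d -> X | forall i,
  seminorm q (g i - iter n.+1 (wshift_prod w lam0) u0 i) < eta].
have nB : nbhs (iter n.+1 (wshift_prod w lam0) u0) B by apply/prod_nbhsP;
  exists q, eta.
move=> /(_ _ nB) [[U V] /= [nU /prod_nbhsP[Q [delta [d0 hV]]]] UV].
have [U' [Q' [delta' [nU' d'0 h']]]] := IH Q delta d0.
exists (U `&` U'), Q', delta'; split=> //; first exact: filterI.
move=> lam u [Ul U'l] Ll hu i.
have Vu : V (iter n (wshift_prod w lam) u) by apply: hV => j; exact: h'.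
by have := UV (lam, iter n (wshift_prod w lam) u) (conj Ul Vu) (conj Ll
  Logic.I) i.
Qed.

End ProductShift.
End Shifts.

(** * Baire's argument and generated algebras *)

Section Baire.
Variables (R : realType) (X : frechetSequenceAlgebraType R) (d : nat).
Implicit Types (q : nat) (u g : 'I_d -> X).

(** Nested closed balls: at stage [j] the radius is at most [2^-j] and the seminorm index at least
    [j], so the centres converge in every component by [seminorm_geometric_complete], and the limit
    stays in all the balls. *)
Lemma prod_baire (O : nat -> set ('I_d -> X)) :
  (forall j u, O j u -> exists q (eps : R), 0 < eps /\
     forall g, (forall i, seminorm q (g i - u i) < eps) -> O j g) ->
  (forall j u q (eps : R), 0 < eps ->
     exists g, O j g /\ forall i, seminorm q (g i - u i) < eps) ->
  exists u, forall j, O j u.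
Proof.
move=> openO denseO.
pose cball (s : ('I_d -> X) * nat * R) g := forall i,
  seminorm s.1.2 (g i - s.1.1 i) <= s.2.
have /choice[step stepP] : forall js : nat * (('I_d -> X) * nat * R),
    exists s, 0 < js.2.2 -> [/\ 0 < s.2 <= 2^-1 ^+ js.1.+1, (js.1.+1 <=
      s.1.2)%N,
      forall i, seminorm js.2.1.2 (s.1.1 i - js.2.1.1 i) <= js.2.2,
      cball s `<=` cball js.2 & cball s `<=` O js.1].
  move=> [j [[u q] r]]; have [r0|r0] := ltP 0 r; last first.
    by exists (u, q, r) => /=; rewrite ltNge r0.
  have r20 : 0 < r / 2 by rewrite divr_gt0.
  have [g [Og gu]] := denseO j u q _ r20.
  have [q1 [e1 [e10 h1]]] := openO j g Og.
  exists (g, maxn (maxn q q1) j.+1, Num.min (Num.min (r / 2) (e1 / 2)) (2^-1 ^+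
    j.+1)) => /= _.
  have p2 : 0 < (2^-1 : R) ^+ j.+1 by rewrite exprn_gt0 // invr_gt0.
  split.
  - by rewrite !lt_min r20 divr_gt0 //= p2 ge_min lexx orbT.
  - exact: leq_maxr.
  - by move=> i; have := gu i; lra.
  - move=> v /= hv i /=; apply: le_trans (seminormB _ _ (g i) _) _.
    have := hv i; rewrite !le_min => /andP[/andP[h _] _].
    have := seminorm_le (v i - g i) (leq_trans (leq_maxl q q1) (leq_maxl _
      j.+1)).
    by have := gu i; lra.
  - move=> v /= hv; apply: h1 => i.
    have := hv i; rewrite !le_min => /andP[/andP[_ h] _].
    have := seminorm_le (v i - g i) (leq_trans (leq_maxr q q1) (leq_maxl _
      j.+1)).
    lra.
pose s := fix s j := if j is j'.+1 then step (j',
  s j') else ((fun=> 0) : 'I_d -> X, 0%N, 1 : R).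
have s0 j : 0 < (s j).2 <= 2^-1 ^+ j.
  elim: j => [|j /andP[IH _]] /=; first by rewrite expr0 ltr01 lexx.
  by have [] := stepP (j, s j) IH.
have sP j := stepP (j, s j) (proj1 (andP (s0 j))).
have sq j : (j <= (s j).1.2)%N by case: j => // j; have [] := sP j.
have sball j n : cball (s j) (s (n + j)%N).1.1.
  have sub : cball (s (n + j)%N) `<=` cball (s j).
    elim: n => // n IH v hv; apply: IH; have [_ _ _ + _] := sP (n + j)%N; exact.
  by apply: sub => i; rewrite subrr seminorm0; have /andP[/ltW] := s0 (n + j)%N.
have /choice[u uP] : forall i, exists x, forall q (eps : R), 0 < eps ->
    exists n0, forall n, (n0 <= n)%N -> seminorm q ((s n).1.1 i - x) < eps.
  move=> i; apply: seminorm_geometric_complete => j.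
  have [_ _ h _ _] := sP j; apply: le_trans (seminorm_le _ (sq j)) _.
  by apply: le_trans (h i) _; have /andP[] := s0 j.
exists u => j; have [_ _ _ _] := sP j; apply => i.
apply/ler_addgt0Pl => r r0.
have [n0 /(_ (n0 + j.+1)%N (leq_addr _ _))] := uP i (s j.+1).1.2 r r0.
have := sball j.+1 n0 i; rewrite seminorm_distC => h1 h2.
rewrite seminorm_distC; apply: le_trans (seminormB _ _ ((s (n0 +
  j.+1)%N).1.1 i) _) _.
by rewrite addrC; apply: lerD => //; exact: ltW.
Qed.

End Baire.

(** * The algebra generated by one vector *)

Section AlgebraOfPowers.
Variables (R : realType) (X : frechetSequenceAlgebraType R) (d : nat).

(* The values at [u] of the polynomials without constant term. *)
Definition generated_algebra (u : 'I_d -> X) : set ('I_d -> X) :=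
  [set z | exists P : {poly R[i]}, P`_0 = 0 /\
    forall i k, seqcoord (z i) k = P.[seqcoord (u i) k]].

Lemma generated_algebra_subalgebra u : subalgebra (generated_algebra u).
Proof.
split.
- by exists 0; split=> [|i k]; rewrite ?coef0 // horner0 seqcoord0.
- move=> z1 z2 [P1 [P10 h1]] [P2 [P20 h2]]; exists (P1 + P2); split=> [|i k].
    by rewrite coefD P10 P20 addr0.
  by rewrite seqcoordD h1 h2 hornerD.
- move=> a z [P [P0 h]]; exists (a *: P); split=> [|i k].
    by rewrite coefZ P0 mulr0.
  by rewrite seqcoordZ h hornerZ.
- move=> z1 z2 [P1 [P10 h1]] [P2 [P20 h2]]; exists (P1 * P2); split=> [|i k].
    by rewrite coefM big_ord1 P10 mul0r.
  by rewrite seqcoord_seqmul h1 h2 hornerM.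
Qed.

Lemma generated_algebra_gen u : generated_algebra u u.
Proof. by exists 'X; split=> [|i k]; rewrite ?coefX // hornerX. Qed.

(** Here [m] is the lowest degree occurring in the polynomial; the absence of a constant term gives
    [1 <= m]. *)
Lemma generated_algebraP u z : generated_algebra u z -> z <> 0 ->
  exists m M (a : nat -> R[i]), [/\ (1 <= m < M)%N, a m != 0 &
    forall i, z i = \sum_(m <= r < M) a r *: pow_prod u r i].
Proof.
move=> [P [P0 hP]] z0.
have P_neq0 : exists r, P`_r != 0.
  apply: contrapT => h; apply: z0; apply/funext => i; apply: seqcoord_ext => k.
  rewrite hP (_ : P = 0) ?horner0 ?seqcoord0 //; apply/polyP => r;
    rewrite coef0.
  by apply/eqP; apply: contrapT => /negP hr; apply: h; exists r.
have [m Pm mP] := ex_minnP P_neq0.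
have m1 : (1 <= m)%N by case: m Pm {mP} => //; rewrite P0 eqxx.
have mM : (m < size P)%N.
  by rewrite ltnNge; apply/negP => h; move: Pm; rewrite nth_default ?eqxx.
exists m, (size P), (fun r => P`_r); split=> //; first by rewrite m1.
move=> i; apply: seqcoord_ext => k; rewrite hP horner_coef seqcoord_sum
  -(big_mkord predT (fun r => P`_r * seqcoord (u i) k ^+ r)).
have mM1 : (m <= size P)%N by exact: ltnW.
rewrite (big_cat_nat (m := 0) (n := m)) //= big_nat_cond big1 ?add0r;
  last first.
  move=> r /andP[/andP[_ rm] _]; case: (eqVneq P`_r 0) => [->|/mP];
    first by rewrite mul0r.
  by rewrite leqNgt rm.
apply: eq_big_nat => r /andP[mr _].
by rewrite seqcoordZ pow_prodE seqcoord_seqpow // (leq_trans m1).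
Qed.

End AlgebraOfPowers.

(** * A density criterion for common hypercyclic algebras *)

Section Criterion.
Variables (R : realType) (X : frechetSequenceAlgebraType R) (e : nat -> X).
Variables (q0 d : nat) (I : set R) (Lam : set ('I_d -> R)) (w : R -> nat -> R).
Hypothesis e_unit : unit_vectors e.
Hypothesis norm_q0 : forall x : X, seminorm q0 x = 0 -> x = 0.
Hypothesis e_basis : unconditional_basis e.
Hypothesis d_ge1 : (1 <= d)%N.
Hypothesis Lam_neq0 : Lam !=set0.
Hypothesis Lam_sigma : sigma_compact Lam.
Hypothesis w_adm : forall lam i, Lam lam -> admissible X (w (lam i)).
Hypothesis w_cont : continuous_family X I Lam w.
Implicit Types (q m t : nat) (u y : 'I_d -> X) (lam : 'I_d -> R).

(* Higher powers have negligible orbits,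
  so that a polynomial in [u] behaves like
   its term of lowest degree [m]. *)
Definition hits u m t y lam := exists n, [/\ (1 <= n)%N,
  forall i, seminorm t (iter n (wshift_prod w lam) (pow_prod u m) i - y i) <
    2^-1 ^+ t &
  forall r, (m < r <= t)%N ->
    forall i, seminorm t (iter n (wshift_prod w lam) (pow_prod u r) i) <
      2^-1 ^+ t].

Let near_pow n r q (eta : R) lam0 u : Lam lam0 -> (1 <= r)%N -> 0 < eta ->
  nbhs (lam0, u) [set z : ('I_d -> R) * ('I_d -> X) | Lam z.1 -> forall i,
    seminorm q (iter n (wshift_prod w z.1) (pow_prod z.2 r) i -
                iter n (wshift_prod w lam0) (pow_prod u r) i) < eta].
Proof.
move=> L0 r1 eta0.
have [U [Q [delta [nU d0 h]]]] :=
  iter_wshift_prod_continuous w_cont n (pow_prod u r) q L0 eta0.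
have /choice[dl dlP] := fun i => @seqpow_continuous _ _ (u i) r Q delta r1 d0.
pose dm := \big[Num.min/1]_(i < d) dl i.
have dm0 : 0 < dm.
  by rewrite /dm; elim/big_ind: _ => [|a b a0 b0|i _]; rewrite ?lt_min ?a0 //;
    case: (dlP i).
exists (U, [set g : 'I_d -> X | forall i, seminorm Q (g i - u i) < dm]).
  by split=> //=; apply/prod_nbhsP; exists Q, dm.
move=> [lam g] [/= Ul hg] Ll; apply: h => // i; rewrite !pow_prodE.
have [_] := dlP i; apply; apply: lt_le_trans (hg i) _.
by rewrite /dm; apply: bigmin_le.
Qed.

(** The hitting time may vary with the parameter. A time that works at [lam0] works for nearby
    parameters and vectors, and compactness of [K] makes the neighbourhood of [u] uniform. *)
Let hits_open (K : set ('I_d -> R)) u m t y : compact K -> K `<=` Lam ->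
  (1 <= m)%N -> (forall lam, K lam -> hits u m t y lam) ->
  exists q (eps : R), 0 < eps /\
    forall g, (forall i, seminorm q (g i - u i) < eps) ->
    forall lam, K lam -> hits g m t y lam.
Proof.
move=> cK KL m1 hu; apply/prod_nbhsP.
have /compact_near_coveringP/near_covering_withinP ncK := cK.
apply: (ncK _ (nbhs u) (fun g lam => hits g m t y lam) (nbhs_filter u)) => lam0
  K0; have L0 := KL _ K0.
have [n [n1 hm hr]] := hu _ K0.
have FF : Filter (nbhs (lam0, u)) by exact: nbhs_filter.
(* Finitely many strict inequalities leave a common margin [rho], which serves as tolerance in
   [near_pow]. *)
have gap (a : 'I_d -> R) (b : R) : (forall i, a i < b) ->
    exists rho, 0 < rho /\ forall i, a i + rho <= b.
  move=> ab; exists (\big[Num.min/1]_(i < d) (b - a i)); split.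
    by elim/big_ind: _ => [|x z x0 z0|i _]; rewrite ?lt_min ?x0 // subr_gt0.
  by move=> i; rewrite addrC -lerBrDr; exact: bigmin_le.
have [rm [rm0 hrm]] := gap _ _ hm.
have n1m := near_pow n t u L0 m1 rm0.
have n2 : forall r : 'I_t.+1, nbhs (lam0, u)
    [set z : ('I_d -> R) * ('I_d -> X) | Lam z.1 -> (m < r)%N -> forall i,
    seminorm t (iter n (wshift_prod w z.1) (pow_prod z.2 r) i) < 2^-1 ^+ t].
  move=> r; have [mr|rm'] := ltnP m r; last by apply: filterE => z _.
  have mrt : (m < r <= t)%N by rewrite mr -ltnS ltn_ord.
  have [rr [rr0 hrr]] := gap _ _ (hr _ mrt).
  apply: filterS (near_pow n t u L0 (leq_trans m1 (ltnW mr)) rr0) => z h Lz _ i.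
  have := seminorm_triangle t (iter n (wshift_prod w z.1) (pow_prod z.2 r) i -
    iter n (wshift_prod w lam0) (pow_prod u r) i) (iter n (wshift_prod w lam0)
      (pow_prod u r) i).
  by rewrite subrK; have := h Lz i; have := hrr i; lra.
have n3 := filter_forall FF n2.
apply: filterS (filterI n1m n3) => -[lam g] [/= h1 h2] /KL Ll; exists n;
  split=> //.
  move=> i; apply: le_lt_trans (seminormB _ _ (iter n (wshift_prod w lam0)
    (pow_prod u m) i) _) _.
  by have := h1 Ll i; have := hrm i; lra.
move=> r /andP[mr rt] i.
by have := h2 (Ordinal (rt : (r < t.+1)%N)) Ll mr i.
Qed.

Let cplx (r : rat * rat) : R[i] := (ratr r.1 +i* ratr r.2)%C.

(** Finitely supported vectors with rational complex coordinates: they are dense, and their codes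
    form a countable type, so [pickle] can enumerate the conditions of Baire's argument. *)
Let target (Y : {ffun 'I_d -> seq (rat * rat)}) (i : 'I_d) : X :=
  \sum_(0 <= k < size (Y i)) cplx (nth (0, 0) (Y i) k) *: e k.

Let cplx_dense (z : R[i]) (eps : R) : 0 < eps -> exists r,
  modulus (cplx r - z) < eps.
Proof.
move=> e0; case: z => a b.
have e20 : 0 < eps / 2 by rewrite divr_gt0.
have app (c : R) : exists r : rat, `|ratr r - c| < eps / 2.
  have [|r] := @rat_in_itvoo _ (c - eps / 2) (c + eps / 2); first by lra.
  by rewrite in_itv /= => h; exists r; rewrite ltr_norml; apply/andP; split;
    lra.
have [r1 h1] := app a; have [r2 h2] := app b; exists (r1, r2).
rewrite /cplx /=; apply: le_lt_trans (_ : `|ratr r1 - a| + `|ratr r2 - b| < _);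
  last by lra.
rewrite -[leRHS]ger0_norm ?addr_ge0 // -sqrtr_sqr ler_sqrt ?sqr_ge0 //.
rewrite -(real_normK (num_real (ratr r1 - a))) -(real_normK (num_real (ratr r2
  - b))).
by have := normr_ge0 (ratr r1 - a); have := normr_ge0 (ratr r2 - b); nra.
Qed.

Let target_dense y q (eps : R) : 0 < eps ->
  exists Y, forall i, seminorm q (target Y i - y i) < eps.
Proof.
move=> e0; have e20 : 0 < eps / 2 by rewrite divr_gt0.
suff /choice[Y hY] : forall i, exists s : seq (rat * rat),
    seminorm q (\sum_(0 <= k < size s) cplx (nth (0, 0) s k) *: e k - y i) <
      eps.
  by exists (finfun Y) => i; rewrite /target ffunE.
move=> i; have [n /(_ n (leqnn _)) hn] :=
  basis_approx e_unit norm_q0 e_basis (y i) q e20.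
pose K := \sum_(0 <= j < n) seminorm q (e j) + 1.
have K0 : 0 < K by rewrite ltr_wpDl // sumr_ge0 // => j _; exact: seminorm_ge0.
have /choice[c hc] : forall k, exists r, modulus (cplx r - seqcoord (y i) k) <
  eps / 2 / K.
  by move=> k; apply: cplx_dense; rewrite divr_gt0.
exists (mkseq c n); rewrite size_mkseq.
apply: le_lt_trans (seminormB _ _ (\sum_(0 <= k <
  n) seqcoord (y i) k *: e k) _) _.
suff : seminorm q (\sum_(0 <= k < n) cplx (nth (0, 0) (mkseq c n) k) *: e k -
    \sum_(0 <= k < n) seqcoord (y i) k *: e k) <= eps / 2 by move: hn; lra.
rewrite -sumrB.
have -> : \sum_(0 <= k < n) (cplx (nth (0,
  0) (mkseq c n) k) *: e k - seqcoord (y i) k *: e k) =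
    \sum_(0 <= k < n) (cplx (c k) - seqcoord (y i) k) *: e k.
  by apply: eq_big_nat => k /andP[_ kn]; rewrite nth_mkseq // scalerBl.
apply: le_trans (seminorm_partial_sum_le e q (r := eps / 2 / K) _) _.
  by move=> j _; exact: ltW.
rewrite -[leRHS](divfK (lt0r_neq0 K0)) ler_wpM2l ?ltW ?divr_gt0 // /K ltrDl //.
Qed.

Lemma hypercyclic_algebra_criterion :
  (forall m t (K : set ('I_d -> R)) y x p q (eta : R),
     (1 <= m)%N -> compact K -> K `<=` Lam -> 0 < eta ->
     (forall i k, (p < k)%N -> seqcoord (y i) k = 0) ->
     (forall i k, (p < k)%N -> seqcoord (x i) k = 0) ->
     exists u, (forall i, seminorm q (u i - x i) < eta) /\
       forall lam, K lam -> hits u m t y lam) ->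
  exists A : set ('I_d -> X), common_hypercyclic_algebra Lam w A.
Proof.
move=> hdense; have [K [cK LamE]] := Lam_sigma.
have KL j : K j `<=` Lam by move=> lam Kl; rewrite LamE; exists j.
pose O (N : nat) : set ('I_d -> X) :=
  if unpickle N is Some (m, t, j, Y) then
    [set u | (1 <= m)%N -> forall lam, K j lam -> hits u m t (target Y) lam]
  else setT.
have p2 (k : nat) : 0 < (2^-1 : R) ^+ k by rewrite exprn_gt0 // invr_gt0.
have [||u uO] := @prod_baire _ X d O.
- move=> N u; rewrite /O; case: unpickle => [[[[m t] j] Y]|]; last first.
    by move=> _; exists 0%N, 1; split.
  case: m => [|m] hu; first by exists 0%N, 1; split=> // g _ /=.
  have [q [eps [e0 h]]] := hits_open (cK j) (KL j) (ltn0Sn m) (hu isT).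
  by exists q, eps; split=> // g hg _; exact: h.
- move=> N x q eps e0; rewrite /O; case: unpickle => [[[[m t] j] Y]|];
    last first.
    by exists x; split=> // i; rewrite subrr seminorm0.
  case: m => [|m]; first by exists x; split=> // i; rewrite subrr seminorm0.
  have e20 : 0 < eps / 2 by rewrite divr_gt0.
  have /choice[n hn] := fun i => basis_approx e_unit norm_q0 e_basis (x i) q
    e20.
  pose p := maxn (\max_(i < d) n i) (\max_(i < d) size (Y i)).
  have [||g [gx hg]] := hdense m.+1 t (K j) (target Y)
    (fun i => \sum_(0 <= k < p) seqcoord (x i) k *: e k) p q (eps / 2) isT (cK
      j) (KL j) e20.
  + move=> i k pk; rewrite /target seqcoord_partial_sum // ltnNge.
    rewrite (leq_trans _ (ltnW pk)) // /p leq_max; apply/orP; right.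
    exact: (leq_bigmax (F := fun i => size (Y i)) i).
  + by move=> i k pk; rewrite seqcoord_partial_sum // ltnNge (ltnW pk).
  exists g; split=> [_ //|i].
  apply: le_lt_trans (seminormB _ _ (\sum_(0 <= k <
    p) seqcoord (x i) k *: e k) _) _.
  have ip : (n i <= p)%N by rewrite /p leq_max (leq_bigmax (F := n) i).
  by have := gx i; have := hn i p ip; lra.
have hits_u m t j Y lam : (1 <= m)%N -> K j lam -> hits u m t (target Y) lam.
  by move=> m1 Kl; have := uO (pickle (m, t, j, Y)); rewrite /O pickleK; apply.
exists (generated_algebra u); split.
- exact: generated_algebra_subalgebra.
- exists u; split; first exact: generated_algebra_gen.
  move=> u0; have [lam] := Lam_neq0; rewrite LamE => -[j _ Kl].
  (* The code [[:: (1, 0)]] stands for [e 0]. If [u] were 0, its orbit would stay at 0, which is at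
     distance at least 1 from [e 0] for [seminorm q0]. *)
  have [n [_ h _]] := hits_u 1%N q0 j [ffun=> [:: (1, 0)]] lam isT Kl.
  pose i0 := Ordinal d_ge1; have := h i0.
  have Ll : Lam lam by exact: KL Kl.
  rewrite iter_wshift_prod pow_prodE u0 /= iter_wshift0; last exact: w_adm.
  rewrite sub0r seminormN ltNge => /negP; apply.
  have := @modulus_seqcoord_le _ _ _ e_unit _ norm_q0 q0 (target [ffun=> [::
    (1, 0)]] i0) 0 (leqnn _).
  rewrite /target ffunE seqcoord_partial_sum //= /cplx /= rmorph1 rmorph0.
  rewrite expr1n expr0n addr0 sqrtr1; apply: le_trans.
  by rewrite exprn_ile1 // ?invr_ge0 // invf_le1 // ler1n.
move=> z [Az z0] lam Ll; apply: hit_hypercyclic => y q eps e0.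
have [m [M [a [/andP[m1 mM] am zE]]]] := generated_algebraP Az z0.
have := Ll; rewrite LamE => -[j _ Kl].
have am0 : 0 < modulus (a m).
  rewrite lt_def modulus_ge0 andbT; apply/eqP =>
    /ComplexField.Normc.eq0_normc/eqP.
  by rewrite (negbTE am).
pose s := \sum_(m <= r < M) modulus (a r).
have s0 : 0 <= s by apply: sumr_ge0 => r _; exact: modulus_ge0.
(* Large enough for all error terms together to stay below [eps / 2], for [seminorm t] to dominate
   [seminorm q], and for [hits] to control every power occurring in [z]. *)
pose t := maxn (Num.bound (s / (eps / 2))) (maxn q M).
have st : s * 2^-1 ^+ t < eps / 2.
  have /upper_nthrootP : (Num.bound (s / (eps / 2)) <= t)%N by rewrite leq_maxl.
  rewrite ltr_pdivrMr ?divr_gt0 // exprVn ltr_pdivrMr ?exprn_gt0 // mulrC //.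
have qt : (q <= t)%N by rewrite /t !leq_max leqnn orbT.
(* The orbit of [u^m] is aimed at [y / a m], since the leading term of [z] is [a m] times [u^m]. *)
have [|Y hY] := @target_dense (fun i => (a m)^-1 *: y i) q (eps / 2 / modulus
  (a m)).
  by rewrite !divr_gt0.
have [n [n1 hm hr]] := hits_u m t j Y lam m1 Kl.
exists n; split=> // i.
have adm := w_adm i Ll.
have -> : iter n (wshift_prod w lam) z i - y i =
   a m *: (target Y i - (a m)^-1 *: y i) +
   (a m *: (iter n (wshift_prod w lam) (pow_prod u m) i - target Y i) +
   \sum_(m.+1 <= r < M) a r *: iter n (wshift_prod w lam) (pow_prod u r) i).
  rewrite iter_wshift_prod zE iter_wshift_sum // big_ltn //.
  rewrite !scalerBr scalerA divff // scale1r iter_wshiftZ // iter_wshift_prod.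
  rewrite addrA [_ - y i + _]addrC subrKA [in RHS]addrAC; congr (_ + _ - _).
  by apply: eq_bigr => r _; rewrite iter_wshiftZ // iter_wshift_prod.
apply: le_lt_trans (seminorm_triangle _ _ _) _; rewrite seminormZ.
have h1 : modulus (a m) * seminorm q (target Y i - (a m)^-1 *: y i) < eps / 2.
  by rewrite mulrC -ltr_pdivlMr.
suff : seminorm q (a m *: (iter n (wshift_prod w lam) (pow_prod u m) i - target
  Y i) +
   \sum_(m.+1 <= r < M) a r *: iter n (wshift_prod w lam) (pow_prod u r) i) <=
     s * 2^-1 ^+ t.
  lra.
rewrite /s [X in _ <= X * _]big_ltn // mulrDl;
  apply: le_trans (seminorm_triangle _ _ _) _.
rewrite seminormZ; apply: lerD.
  rewrite ler_wpM2l ?modulus_ge0 //; apply: le_trans (seminorm_le _ qt) _;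
    exact: ltW.
apply: le_trans (seminorm_sum _ _ _ _) _; rewrite mulr_suml.
rewrite big_nat_cond [leRHS]big_nat_cond;
  apply: ler_sum => r /andP[/andP[mr rM] _].
rewrite seminormZ ler_wpM2l ?modulus_ge0 //;
  apply: le_trans (seminorm_le _ qt) _.
apply: ltW; apply: hr; rewrite mr /= /t.
by rewrite !leq_max (ltnW rM) !orbT.
Qed.

End Criterion.

(** * Products of weights *)

Section FNorm.
Variables (R : realType) (X : frechetSequenceAlgebraType R) (Fnorm : X -> R).
Hypothesis Fnorm_X : is_Fnorm Fnorm.

Lemma seminorm_small_Fnorm (eps : R) : 0 < eps ->
  exists Q (delta : R), 0 < delta /\
    forall x, seminorm Q x < delta -> Fnorm x < eps.
Proof.
move=> e0; have : nbhs 0 [set v | Fnorm v < eps].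
  apply/(Fnorm_nbhs Fnorm_X); exists eps; split=> // v; rewrite sub0r.
  have := @Fnorm_scale_le1 _ _ _ Fnorm_X (-1) (- v);
    rewrite scaleN1r opprK => h /=.
  apply: le_lt_trans; apply: h.
  by rewrite -[-1](rmorphN1 (real_complex R)) modulus_real normrN1.
move=> /seminorm_nbhsP[Q [delta [d0 h]]]; exists Q, delta; split=> // x hx.
by apply: h; rewrite subr0.
Qed.

Lemma Fnorm_small_seminorm q (eta : R) : 0 < eta ->
  exists eps, 0 < eps /\ forall x, Fnorm x < eps -> seminorm q x < eta.
Proof.
move=> eta0; have /(Fnorm_nbhs Fnorm_X)[eps [e0 h]] :=
  @seminorm_ball_nbhs _ _ q (0 : X) _ eta0.
exists eps; split=> // x hx; have := h (- x);
  rewrite sub0r opprK /= subr0 seminormN.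
exact.
Qed.

End FNorm.

Section SparseSums.
Variables (R : realType) (X : frechetSequenceAlgebraType R) (e : nat -> X).
Hypothesis e_unit : unit_vectors e.
Variables (J : eqType) (r : seq J) (g : J -> nat) (a : J -> R[i]).
Hypothesis r_uniq : uniq r.
Hypothesis g_inj : {in r &, injective g}.

Lemma seqcoord_sparse_in j : j \in r ->
  seqcoord (\sum_(k <- r) a k *: e (g k)) (g j) = a j.
Proof.
move=> jr; rewrite seqcoord_sum (bigD1_seq j) //= seqcoordZ e_unit eqxx mulr1.
rewrite big_seq_cond big1 ?addr0 // => k /andP[kr kj].
rewrite seqcoordZ e_unit; case: eqP => [h|]; last by rewrite mulr0.
by rewrite (g_inj jr kr h) eqxx in kj.
Qed.

Lemma seqcoord_sparse_out s : (forall k, k \in r -> g k <> s) ->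
  seqcoord (\sum_(k <- r) a k *: e (g k)) s = 0.
Proof.
move=> h; rewrite seqcoord_sum big_seq big1 // => k kr.
rewrite seqcoordZ e_unit; case: eqP => [hs|]; last by rewrite mulr0.
by case: (h k kr).
Qed.

End SparseSums.

Section WeightProducts.
Variables (R : realType) (I : set R) (w : R -> nat -> R) (F : nat ->
  R) (c C : R).
Hypothesis w_gt0 : forall a n, I a -> (1 <= n)%N -> 0 < w a n.
Hypothesis w_nondecr : forall n, (1 <= n)%N ->
  forall a b, I a -> I b -> a <= b -> w a n <= w b n.
Hypothesis F_gt0 : forall n, 0 < F n.
Hypothesis F_nondecr : forall n p, (n <= p)%N -> F n <= F p.
Hypothesis c_gt0 : 0 < c.
Hypothesis C_gt0 : 0 < C.
Hypothesis w_ratio : forall n, (1 <= n)%N -> forall a b, I a -> I b ->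
  c <= w a n / w b n.

(** The factor that the [n]-th coordinate acquires when the shift carries it down to position
    [l]. *)
Definition wprod (a : R) l n : R := \prod_(l.+1 <= v < n.+1) w a v.

Lemma wprod_gt0 a l n : I a -> 0 < wprod a l n.
Proof.
move=> Ia; rewrite /wprod big_nat_cond; apply: prodr_gt0 => v /andP[/andP[lv _]
  _].
by apply: w_gt0 => //; apply: leq_trans lv.
Qed.

Lemma wprod_cat a l k n : (l <= k <= n)%N ->
  wprod a l n = wprod a l k * wprod a k n.
Proof. by move=> /andP[lk kn]; rewrite /wprod (big_cat_nat (n := k.+1)). Qed.

Lemma wprod_le a b l n : I a -> I b -> a <= b -> wprod a l n <= wprod b l n.
Proof.
move=> Ia Ib ab; rewrite /wprod big_nat_cond [leRHS]big_nat_cond.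
apply: ler_prod => v /andP[/andP[lv _] _]; have v1 : (1 <=
  v)%N by apply: leq_trans lv.
by rewrite ltW ?w_gt0 ?w_nondecr.
Qed.

(** Only an upper bound [p] on the number of factors is given, hence the requirement [k <= 1]. *)
Lemma wprod_lower (k : R) a l n p : I a -> (n <= l + p)%N -> 0 < k <= 1 ->
  (forall v, (1 <= v)%N -> k <= w a v) -> k ^+ p <= wprod a l n.
Proof.
move=> Ia nlp /andP[k0 k1] kw.
apply: le_trans (_ : k ^+ (n - l) <= _).
  by apply: ler_wiXn2l => //; [exact: ltW | rewrite leq_subLR].
have -> : k ^+ (n - l) = \prod_(l.+1 <= v <
  n.+1) k by rewrite prodr_const_nat subSS.
rewrite /wprod big_nat_cond [leRHS]big_nat_cond.
apply: ler_prod => v /andP[/andP[lv _] _]; have v1 : (1 <=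
  v)%N by apply: leq_trans lv.
by rewrite ltW // kw.
Qed.

Lemma ratio_const_le1 : I !=set0 -> c <= 1.
Proof.
move=> [a Ia]; have := w_ratio (ltnSn 0) Ia Ia.
by rewrite divff // gt_eqF // w_gt0.
Qed.

Lemma wprod_comparable a b l n p : I a -> I b -> (n <= l + p)%N ->
  c ^+ p * wprod b l n <= wprod a l n.
Proof.
move=> Ia Ib nlp; have c1 := ratio_const_le1 (ex_intro _ a Ia).
apply: le_trans (_ : c ^+ (n - l) * wprod b l n <= _).
  apply: ler_wpM2r; first by rewrite ltW // wprod_gt0.
  by apply: ler_wiXn2l => //; [exact: ltW | rewrite leq_subLR].
have -> : c ^+ (n - l) = \prod_(l.+1 <= v <
  n.+1) c by rewrite prodr_const_nat subSS.
rewrite /wprod -big_split /= big_nat_cond [leRHS]big_nat_cond.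
apply: ler_prod => v /andP[/andP[lv _] _]; have v1 : (1 <=
  v)%N by apply: leq_trans lv.
apply/andP; split; first by rewrite ltW // mulr_gt0 // w_gt0.
by rewrite -ler_pdivlMr ?w_gt0 ?w_ratio.
Qed.

Lemma wprod_expR a n : I a -> wprod a 0 n = expR (\sum_(1 <= k <
  n.+1) ln (w a k)).
Proof.
move=> Ia; rewrite /wprod expR_sum big_nat_cond [RHS]big_nat_cond.
by apply: eq_bigr => v /andP[/andP[v1 _] _]; rewrite lnK // posrE w_gt0.
Qed.

Hypothesis f_lip : forall n, (1 <= n)%N -> forall a b, I a -> I b ->
  `|\sum_(1 <= k < n.+1) ln (w a k) - \sum_(1 <= k < n.+1) ln (w b k)|
  <= C * F n * `|b - a|.

(* As every factor is nondecreasing in the parameter, the ratio over a final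
   segment of indices is at least the ratio over all of them. *)
Lemma wprod_lipschitz a b l n N tau : I a -> I b -> (l <= n <= N)%N ->
  0 <= tau -> a <= b -> b - tau / F N <= a ->
  expR (- (C * tau)) * wprod b l n <= wprod a l n.
Proof.
move=> Ia Ib /andP[ln nN] tau0 ab ba.
have [n0|n1] := posnP n.
  rewrite n0 /wprod !big_geq // mulr1 -[leRHS]expR0 ler_expR oppr_le0.
  by rewrite mulr_ge0 // ltW.
have h0 : expR (- (C * tau)) * wprod b 0 n <= wprod a 0 n.
  rewrite !wprod_expR // -expRD ler_expR.
  have := f_lip n1 Ia Ib; rewrite ler_norml => /andP[+ _].
  rewrite ger0_norm ?subr_ge0 // => h.
  suff : C * F n * (b - a) <= C * tau by move: h; lra.
  rewrite -mulrA ler_wpM2l ?(ltW C_gt0) //.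
  apply: le_trans (_ : F n * (tau / F N) <= _).
    by rewrite ler_wpM2l ?(ltW (F_gt0 _)) //; lra.
  rewrite mulrCA ler_piMr // ler_pdivrMr ?F_gt0 // mul1r; exact: F_nondecr.
have pa := wprod_gt0 0 l Ia.
rewrite -(ler_pM2l pa) -wprod_cat ?ln //; apply: le_trans h0.
rewrite (wprod_cat b (l := 0) (k := l)) ?ln // mulrCA ler_wpM2l ?expR_ge0 //.
by apply: ler_wpM2r; [exact/ltW/wprod_gt0 | exact: wprod_le].
Qed.

End WeightProducts.

(** * From the covering condition to density *)

Section CoveringCondition.
Variables (R : realType) (X : frechetSequenceAlgebraType R) (Fnorm : X -> R).
Variables (e : nat -> X) (I : set R) (d : nat).
Variables (w : R -> nat -> R) (F : nat -> R).

(* Condition (c) for given [m], [tau], [N], [eps] and [K]. *)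
Definition covering (m : nat) (tau : R) (N : nat) (eps : R)
    (K : set ('I_d -> R)) := exists (q : nat) (n : nat -> nat) (lam : nat ->
      'I_d -> R),
  [/\ (1 <= q)%N,
      (N <= n 1)%N /\ (forall k, (1 <= k < q)%N -> (n k + N <= n k.+1)%N) &
      (forall k, (1 <= k <= q)%N -> forall i, I (lam k i))] /\
  [/\ K `<=` \bigcup_(k in [set k | (1 <= k <= q)%N])
               [set mu | forall l, lam k l - tau / F (n k) <= mu l <= lam k l],
      (forall i, Fnorm (\sum_(1 <= k < q.+1)
         (1 / wprod w (lam k i) 0 (n k) `^ (1 / m%:R))%:C *: e (n k)) < eps) &
      (forall k, (1 <= k <= q)%N -> forall i l, (l <= N)%N ->
         Fnorm (\sum_(k.+1 <= j < q.+1)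
           (wprod w (lam k i) (n j - n k + l) (n j + l) /
            wprod w (lam j i) l (n j + l))%:C *: e (n j - n k + l)%N) < eps)].

Variables (c C : R) (q0 : nat) (Lam : set ('I_d -> R)).
Hypothesis Fnorm_X : is_Fnorm Fnorm.
Hypothesis e_unit : unit_vectors e.
Hypothesis norm_q0 : forall x : X, seminorm q0 x = 0 -> x = 0.
Hypothesis e_basis : unconditional_basis e.
Hypothesis I_neq0 : I !=set0.
Hypothesis Lam_I : Lam `<=` [set lam | forall i, I (lam i)].
Hypothesis w_adm : forall a, I a -> admissible X (w a).
Hypothesis w_nondecr : forall n, (1 <= n)%N ->
  forall a b, I a -> I b -> a <= b -> w a n <= w b n.
Hypothesis w_inf : 0 < inf [set w na.2 na.1 | na in [set n | (1 <= n)%N] `*` I].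
Hypothesis F_gt0 : forall n, 0 < F n.
Hypothesis F_nondecr : forall n p, (n <= p)%N -> F n <= F p.
Hypothesis c_gt0 : 0 < c.
Hypothesis C_gt0 : 0 < C.
Hypothesis w_ratio : forall n, (1 <= n)%N -> forall a b, I a -> I b ->
  c <= w a n / w b n.
Hypothesis f_lip : forall n, (1 <= n)%N -> forall a b, I a -> I b ->
  `|\sum_(1 <= k < n.+1) ln (w a k) - \sum_(1 <= k < n.+1) ln (w b k)|
  <= C * F n * `|b - a|.

Lemma admissible_gt0 a n : I a -> (1 <= n)%N -> 0 < w a n.
Proof. by move=> Ia n1; have [h _ _] := w_adm Ia; exact: h. Qed.

Lemma weights_lower_bound : exists iota, 0 < iota <= 1 /\
  forall a v, I a -> (1 <= v)%N -> iota <= w a v.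
Proof.
exists (Num.min 1 (inf [set w na.2 na.1 | na in [set n | (1 <= n)%N] `*` I])).
rewrite lt_min ltr01 w_inf ge_min lexx; split=> // a v Ia v1.
rewrite ge_min; apply/orP; right; apply: ge_inf; last by exists (v, a).
by exists 0 => _ [[k b] [/= k1 Ib] <-]; rewrite ltW // admissible_gt0.
Qed.

Let wp_gt0 a l n : I a -> 0 < wprod w a l n :=
  @wprod_gt0 _ _ _ admissible_gt0 a l n.

Lemma separated_indices N q (n : nat -> nat) :
  (forall k, (1 <= k < q)%N -> (n k + N <= n k.+1)%N) ->
  forall k j, (1 <= k)%N -> (k < j <= q)%N -> (n k + N <= n j)%N.
Proof.
move=> hn k j k1 /andP[]; elim: j => // j IH;
  rewrite ltnS leq_eqVlt => /orP[/eqP <-|kj] jq.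
  by apply: hn; rewrite k1.
apply: leq_trans (IH kj (ltnW jq)) _.
apply: leq_trans (leq_addr _ _) (hn j _); rewrite jq andbT.
by apply: leq_trans kj.
Qed.

Lemma complex_root m (z : R[i]) : (1 <= m)%N -> exists h : R[i], h ^+ m = z.
Proof. by move=> m1; exists (m.-root z); rewrite rootCK. Qed.

Let Rroot m (r : R) : (1 <= m)%N -> 0 < r -> 0 <
  r `^ (1 / m%:R) /\ (r `^ (1 / m%:R)) ^+ m = r.
Proof.
move=> m1 r0; split; first by rewrite powR_gt0.
by rewrite div1r -powR_mulrn ?powR_ge0 // -powRrM mulVf ?powRr1 ?ltW //
  pnatr_eq0 -lt0n.
Qed.

(** * The perturbation built from a covering, and its orbits *)

Section Perturbation.
Variables (m p nq : nat) (n : nat -> nat) (lam : nat -> 'I_d -> R).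
Variable y : 'I_d -> X.
Hypothesis m1 : (1 <= m)%N.
Hypothesis n_ge : (2 * p + 1 <= n 1)%N.
Hypothesis n_sep : forall k, (1 <= k < nq)%N -> (n k + (2 * p + 1) <= n k.+1)%N.
Hypothesis lam_I : forall k, (1 <= k <= nq)%N -> forall i, I (lam k i).

Let idx : seq (nat * nat) := [seq (k, l) | k <- index_iota 1 nq.+1,
  l <- index_iota 0 p.+1].
Let pos (kl : nat * nat) := (n kl.1 - p + kl.2)%N.

Let mem_idx k l : ((k, l) \in idx) = (1 <= k <= nq)%N && (l <= p)%N.
Proof.
apply/allpairsP/andP => [[[a b] [/= + + [-> ->]]]|[hk lp]].
  by rewrite !mem_index_iota !ltnS.
by exists (k, l); rewrite !mem_index_iota !ltnS.
Qed.

Let n_min k : (1 <= k <= nq)%N -> (2 * p + 1 <= n k)%N.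
Proof.
move=> /andP[]; rewrite leq_eqVlt => /orP[/eqP <- //|k1 kq].
have := separated_indices n_sep (leqnn 1%N) (j := k);
  rewrite k1 kq => /(_ isT); lia.
Qed.

Let n_gap k k' : (1 <= k <= nq)%N -> (1 <= k' <= nq)%N -> k != k' ->
  (n k + (2 * p + 1) <= n k')%N || (n k' + (2 * p + 1) <= n k)%N.
Proof.
move=> /andP[k1 kq] /andP[k'1 k'q]; case: (ltngtP k k') => // kk _; apply/orP;
  [left|right].
  by apply: (separated_indices n_sep k1); rewrite kk.
by apply: (separated_indices n_sep k'1); rewrite kk.
Qed.

Let n_inj : {in index_iota 1 nq.+1 &, injective n}.
Proof.
move=> k k'; rewrite !mem_index_iota !ltnS => hk hk' E.
by apply/eqP; apply: contraT => /(n_gap hk hk'); rewrite E; clear; lia.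
Qed.

Let pos_inj : {in idx &, injective pos}.
Proof.
move=> [k l] [k' l']; rewrite !mem_idx => /andP[hk lp] /andP[hk' lp'] /=.
rewrite /pos /= => E; have [kk|kk] := eqVneq k k'.
  by move: E; rewrite kk => /addnI ->.
move: (n_min hk) (n_min hk') (n_gap hk hk' kk) lp lp' E; clear; lia.
Qed.

Variable h : 'I_d -> nat -> R[i].
Hypothesis h_root : forall i l, h i l ^+ m = seqcoord (y i) l.

(** An [m]-th root of [y_l] divided by the weight product from [l] to the position of [(k, l)]. At
    parameter [lam k], the shift by [n k - p] then carries the [k]-th block of the [m]-th power
    exactly onto [y]. *)
Let gam i (kl : nat * nat) : R[i] := h i kl.2 *
  ((wprod w (lam kl.1 i) kl.2 (pos kl))^-1 `^ (1 / m%:R))%:C.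

Definition perturbation i : X := \sum_(kl <- idx) gam i kl *: e (pos kl).

Let uniq_idx : uniq idx.
Proof. by apply: allpairs_uniq; rewrite ?iota_uniq // => -[a b] [a' b']. Qed.

Lemma perturbation_in i k l : (1 <= k <= nq)%N -> (l <= p)%N ->
  seqcoord (perturbation i) (n k - p + l)%N ^+ m =
    seqcoord (y i) l / (wprod w (lam k i) l (n k - p + l))%:C.
Proof.
move=> hk lp; have kl : (k, l) \in idx by rewrite mem_idx hk lp.
rewrite -[(n k - p + l)%N]/(pos (k, l)) /perturbation.
rewrite (seqcoord_sparse_in _ _ uniq_idx pos_inj kl) //= /gam exprMn h_root
  -rmorphXn.
have r0 : 0 < (wprod w (lam k i) l (pos (k, l)))^-1.
  by rewrite invr_gt0; apply/wp_gt0/lam_I.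
by have [_ ->] := Rroot m1 r0; rewrite fmorphV.
Qed.

Lemma perturbation_out i s :
  (forall k l, (1 <= k <= nq)%N -> (l <= p)%N -> (n k - p + l)%N <> s) ->
  seqcoord (perturbation i) s = 0.
Proof.
move=> hs; rewrite /perturbation seqcoord_sparse_out // => -[k l].
by rewrite mem_idx => /andP[hk lp]; exact: hs.
Qed.

(* The shift undoes the translation by [p], which is how the coordinates of the
   perturbation are compared with those of the sum in (ii). *)
Lemma perturbation_dominated (Y a0 iota : R) i s :
  1 <= Y -> I a0 -> 0 < iota <= 1 ->
  (forall a v, I a -> (1 <= v)%N -> iota <= w a v) ->
  (forall l, modulus (seqcoord (y i) l) <= Y) ->
  modulus (seqcoord (perturbation i) s) <=
  Y * ((iota ^+ p)^-1 +
       ((c ^+ p)^-1 * \sum_(0 <= l < p.+1) wprod w a0 0 l) * (c ^+ p)^-1) *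
  modulus (seqcoord (\sum_(0 <= j < p.+1) iter j (wshift (w a0))
    (\sum_(1 <= k < nq.+1)
      (1 / wprod w (lam k i) 0 (n k) `^ (1 / m%:R))%:C *: e (n k))) s).
Proof.
move=> Y1 Ia0 /andP[io0 io1] w_iota hY; set G := \sum_(1 <= k < nq.+1) _.
set D := \sum_(0 <= l < p.+1) wprod w a0 0 l.
have Y0 : 0 <= Y by apply: le_trans Y1.
have cp0 : 0 < c ^+ p by rewrite exprn_gt0.
have ip0 : 0 < iota ^+ p by rewrite exprn_gt0.
have D0 : 0 <= D by apply: sumr_ge0 => l _; exact/ltW/wp_gt0.
have M0 : 0 <= Y * ((iota ^+ p)^-1 + ((c ^+ p)^-1 * D) * (c ^+ p)^-1).
  by rewrite mulr_ge0 // addr_ge0 ?invr_ge0 ?(ltW ip0) // !mulr_ge0 // invr_ge0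
    ltW.
have [[k [l [hk lp sE]]]|hs] :=
  pselect (exists k l, [/\ (1 <= k <= nq)%N, (l <= p)%N & (n k - p +
    l)%N = s]); last first.
  rewrite perturbation_out; first by rewrite ComplexField.Normc.normc0 mulr_ge0
    ?modulus_ge0.
  by move=> k l hk lp sE; apply: hs; exists k, l.
have Ik := lam_I hk i; set b := lam k i in Ik.
have nk := n_min hk.
(* Among the shifts by [j <= p], only [j = p - l] brings a term of [G] to position [s]: any other
   would need some [n k'] within [p] of [n k]. *)
have sn : (p - l + s)%N = n k by move: nk lp sE; clear; lia.
have GE : seqcoord G (n k) = (1 / wprod w b 0 (n k) `^ (1 / m%:R))%:C.
  have kin : k \in index_iota 1 nq.+1 by rewrite mem_index_iota ltnS.
  exact: (seqcoord_sparse_in e_unit _ (iota_uniq _ _) n_inj kin).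
have GO j : (j <= p)%N -> j != (p - l)%N -> seqcoord G (j + s)%N = 0.
  move=> jp jl; apply: (seqcoord_sparse_out e_unit) => k';
    rewrite mem_index_iota ltnS => hk' E.
  have [kk|kk] := eqVneq k k'; first by move: jl; rewrite -kk -sn in E;
    move/addIn: E => ->; rewrite eqxx.
  move: (n_gap hk hk' kk) nk jp lp sE E; clear; lia.
have -> : seqcoord (\sum_(0 <= j < p.+1) iter j (wshift (w a0)) G) s =
    (wprod w a0 s (n k) * (1 / wprod w b 0 (n k) `^ (1 / m%:R)))%:C.
  rewrite seqcoord_sum (bigD1_seq (p - l)%N) ?iota_uniq ?mem_index_iota ?ltnS
    ?leq_subr //=.
  rewrite big_seq_cond big1 ?addr0 => [|j /andP[]].
    by rewrite (seqcoord_iter_wshift (w_adm Ia0)) sn GE -rmorphM.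
  rewrite mem_index_iota ltnS => /andP[_ jp] jl.
  by rewrite (seqcoord_iter_wshift (w_adm Ia0)) GO // mulr0.
set P := wprod w b 0 (n k); have P0 : 0 < P by exact: wp_gt0.
have [g0 gm] := Rroot m1 P0; set g := P `^ (1 / m%:R) in g0 gm *.
have W0 : 0 < wprod w a0 s (n k) by exact: wp_gt0.
rewrite modulus_real ger0_norm; last by rewrite mulr_ge0 ?ltW // div1r invr_gt0.
have kl : (k, l) \in idx by rewrite mem_idx hk lp.
rewrite -sE -[(n k - p + l)%N]/(pos (k, l)) /perturbation.
rewrite (seqcoord_sparse_in _ _ uniq_idx pos_inj kl) //= /gam.
rewrite ComplexField.Normc.normcM modulus_real [pos (k, l)]sE /= -/b.
have Wi : 0 < (wprod w b l s)^-1 by rewrite invr_gt0; exact: wp_gt0.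
have [r0 rm] := Rroot m1 Wi; set rho := _ `^ _ in r0 rm *; rewrite gtr0_norm //.
(* The bound on [y_l] passes to its [m]-th root because [1 <= Y]. *)
have hY' : modulus (h i l) <= Y.
  have [h1|/ltW h1] := leP (modulus (h i l)) 1; first exact: le_trans Y1.
  apply: le_trans (ler_eXnr m1 h1) _; rewrite -modulusX h_root; exact: hY.
rewrite -mulrA; apply: ler_pM => //; [exact: modulus_ge0 | exact: ltW |].
(* The product [P] up to [n k], deprived of the factors between [l] and [s] that occur in the
   perturbation: two pieces of at most [p] factors each. Thus [rho] is the [m]-th root of
   [Q / P]. *)
pose Q := wprod w b 0 l * wprod w b s (n k).
have Q0 : 0 < Q by rewrite mulr_gt0 ?wp_gt0.
have ls : (l <= s <= n k)%N by rewrite -sn leq_addl andbT -sE leq_addl.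
have PE : P = Q * wprod w b l s.
  have l0n : (0 <= l <= n k)%N by case/andP: ls => /leq_trans; exact.
  rewrite /P (@wprod_cat _ w b _ _ _ l0n) (@wprod_cat _ w b _ _ _ ls) /Q.
  by rewrite -mulrA [X in _ * X]mulrC.
(* The [m]-th root of [Q] is bounded by [1 + Q], whatever [m] is. *)
have rho_le : rho <= (1 + Q) * (1 / g).
  rewrite -(ler_pXn2r m1) ?nnegrE ?(ltW r0) //; last first.
    by rewrite mulr_ge0 ?div1r ?invr_ge0 ?(ltW g0) // addr_ge0 // ltW.
  rewrite rm exprMn expr_div_n expr1n gm div1r PE invfM mulrA.
  apply: ler_peMl; first by rewrite ltW.
  rewrite ler_pdivlMr // mul1r; apply: le_trans (_ : 1 + Q <= _);
    first by rewrite lerDr.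
  by rewrite ler_eXnr // lerDl ltW.
apply: le_trans rho_le _; rewrite mulrA ler_wpM2r //;
  first by rewrite div1r invr_ge0 ltW.
(* The summand 1 is paid for by the lower bound [iota ^+ p] on the weights of the shift at [a0]; the
   summand [Q] by comparing both of its pieces with parameter [a0]. *)
rewrite mulrDl; apply: lerD.
  rewrite mulrC ler_pdivlMr // mul1r; apply: (wprod_lower Ia0); rewrite ?io0 //.
    by rewrite addnC -sn leq_add2r leq_subr.
  by move=> v v1; exact: w_iota.
have nsp : (n k <= s + p)%N by rewrite addnC -sn leq_add2r leq_subr.
have lip1 := wprod_comparable admissible_gt0 c_gt0 w_ratio Ia0 Ik (leq_trans lp
  (leqnn (0 + p)%N)).
have lip2 := wprod_comparable admissible_gt0 c_gt0 w_ratio Ia0 Ik nsp.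
have lD : wprod w a0 0 l <= D.
  rewrite /D (bigD1_seq l) ?iota_uniq ?mem_index_iota ?ltnS //= lerDl.
  by apply: sumr_ge0 => j _; exact/ltW/wp_gt0.
rewrite /Q -[leRHS]mulrA.
apply: ler_pM; [exact/ltW/wp_gt0 | exact/ltW/wp_gt0 | |].
  by rewrite mulrC ler_pdivlMr // mulrC; apply: le_trans lip1 lD.
by rewrite mulrC ler_pdivlMr // mulrC.
Qed.

(** Adding the vectors of (iii) over [l <= p] gives one majorant for all the later blocks at once,
    because the positions are pairwise distinct. *)
Let Hsum i k0 : X := \sum_(0 <= l < p.+1) \sum_(k0.+1 <= j < nq.+1)
  (wprod w (lam k0 i) (n j - n k0 + l) (n j + l) /
   wprod w (lam j i) l (n j + l))%:C *: e (n j - n k0 + l)%N.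

Let Hidx k0 := [seq (l, j) | l <- index_iota 0 p.+1,
  j <- index_iota k0.+1 nq.+1].

Let mem_Hidx k0 l j : ((l, j) \in Hidx k0) = (l <= p)%N && (k0 < j <= nq)%N.
Proof.
apply/allpairsP/andP => [[[a b] [/= + + [-> ->]]]|[lp hj]].
  by rewrite !mem_index_iota !ltnS.
by exists (l, j); rewrite !mem_index_iota !ltnS.
Qed.

Let Hpos k0 (lj : nat * nat) := (n lj.2 - n k0 + lj.1)%N.

Let later_index k0 j : (1 <= k0 <= nq)%N -> (k0 < j <= nq)%N ->
  (1 <= j <= nq)%N /\ (n k0 + (2 * p + 1) <= n j)%N.
Proof.
move=> /andP[k01 _] hj; split; last exact: (separated_indices n_sep k01 hj).
by case/andP: hj => k0j ->; rewrite andbT (leq_trans k01) // ltnW.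
Qed.

Let Hpos_inj k0 : (1 <= k0 <= nq)%N -> {in Hidx k0 &, injective (Hpos k0)}.
Proof.
move=> hk0 [l j] [l' j']; rewrite !mem_Hidx => /andP[lp hj] /andP[l'p hj'].
have [j1 nj] := later_index hk0 hj; have [j'1 nj'] := later_index hk0 hj'.
rewrite /Hpos /= => E; have [jj|jj] := eqVneq j j'.
  by move: E; rewrite jj => /addnI ->.
move: nj nj' (n_gap j1 j'1 jj) lp l'p E; clear; lia.
Qed.

Let HsumE i k0 : Hsum i k0 = \sum_(lj <- Hidx k0)
  (wprod w (lam k0 i) (Hpos k0 lj) (n lj.2 + lj.1) /
   wprod w (lam lj.2 i) lj.1 (n lj.2 + lj.1))%:C *: e (Hpos k0 lj).
Proof. by rewrite big_allpairs. Qed.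

Let Hsum_in i k0 l j : (1 <= k0 <= nq)%N -> (l <= p)%N -> (k0 < j <= nq)%N ->
  seqcoord (Hsum i k0) (n j - n k0 + l)%N =
  (wprod w (lam k0 i) (n j - n k0 + l) (n j + l) /
   wprod w (lam j i) l (n j + l))%:C.
Proof.
move=> hk0 lp hj.
rewrite HsumE.
have lj : (l, j) \in Hidx k0 by rewrite mem_Hidx lp hj.
have u : uniq (Hidx k0) by apply: allpairs_uniq;
  rewrite ?iota_uniq // => -[? ?] [].
exact: (seqcoord_sparse_in e_unit _ u (Hpos_inj hk0) lj).
Qed.

Let Hsum_out i k0 s : (forall l j, (l <= p)%N -> (k0 < j <= nq)%N ->
    (n j - n k0 + l)%N <> s) -> seqcoord (Hsum i k0) s = 0.
Proof.
move=> hs.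
rewrite HsumE.
apply: (seqcoord_sparse_out e_unit) => -[l j]; rewrite mem_Hidx => /andP[lp hj].
exact: hs.
Qed.

(** After [n k0 - p] shifts, [x] and the earlier blocks have disappeared, block [k0] occupies [0, p]
    and the later blocks lie beyond [p]. On [0, p] the error is at most [sigma] times [y]; beyond,
    it is controlled by (iii). Supports being disjoint, powers act block by block. *)
Lemma perturbation_orbit i k0 a (x : X) (tau sigma Y : R) r s :
  (1 <= k0 <= nq)%N -> I a -> 0 <= tau ->
  lam k0 i - tau / F (n k0) <= a <= lam k0 i ->
  1 - expR (- (C * tau)) <= sigma -> sigma <= 1 -> 1 <= Y ->
  (forall l, modulus (seqcoord (y i) l) <= Y) ->
  (forall k, (p < k)%N -> seqcoord x k = 0) ->
  (forall k, (p < k)%N -> seqcoord (y i) k = 0) ->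
  (forall k, modulus (seqcoord (perturbation i) k) <= sigma) ->
  (m <= r)%N ->
  modulus (seqcoord (iter (n k0 - p) (wshift (w a)) (seqpow (x +
    perturbation i) r) -
    (if r == m then y i else 0)) s) <=
  Y / c ^+ p * modulus (seqcoord (sigma%:C *: y i +
    \sum_(0 <= l < p.+1) \sum_(k0.+1 <= j < nq.+1)
      (wprod w (lam k0 i) (n j - n k0 + l) (n j + l) /
       wprod w (lam j i) l (n j + l))%:C *: e (n j - n k0 + l)%N) s).
Proof.
move=> hk0 Ia tau0 /andP[ab1 ab2] sig sig1 Y1 hY xp yp psig mr.
have Ib := lam_I hk0 i; set b := lam k0 i in Ib ab1 ab2 *.
rewrite -/(Hsum i k0).
have sig0 : 0 <= sigma by apply: le_trans (psig 0%N); exact: modulus_ge0.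
have c1 : c <= 1 := ratio_const_le1 admissible_gt0 w_ratio I_neq0.
have cp0 : 0 < c ^+ p by rewrite exprn_gt0.
have cp1 : c ^+ p <= 1 by rewrite exprn_ile1 // ltW.
have M1 : 1 <= Y / c ^+ p.
  by rewrite ler_pdivlMr // mul1r; apply: le_trans Y1.
have r1 : (1 <= r)%N by apply: leq_trans mr.
have nk0 := n_min hk0.
rewrite seqcoordB (seqcoord_iter_wshift (w_adm Ia)) -/(wprod w a s (n k0 - p +
  s)%N).
rewrite seqcoord_seqpow // !seqcoordD seqcoordZ.
have -> : seqcoord (if r == m then y i else 0) s = if r == m then seqcoord (y
  i) s else 0.
  by case: ifP => _ //; rewrite seqcoord0.
have -> : seqcoord x (n k0 - p + s)%N = 0.
  by apply: xp; move: nk0; clear; lia.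
rewrite add0r.
have powm t : modulus (seqcoord (perturbation i) t) ^+ r <=
    modulus (seqcoord (perturbation i) t) ^+ m.
  by apply: ler_wiXn2l => //; [exact: modulus_ge0 | exact: le_trans (psig t)
    sig1].
have [sp|ps] := leqP s p.
  have -> : seqcoord (Hsum i k0) s = 0.
    apply: Hsum_out => l j lp hj; have [_ nj] := later_index hk0 hj.
    move: nj sp; clear; lia.
  have pm := perturbation_in i hk0 sp; rewrite -/b in pm.
  have Wa := wp_gt0 s (n k0 - p + s) Ia; have Wb := wp_gt0 s (n k0 - p + s) Ib.
  set v := seqcoord (perturbation i) (n k0 - p + s) in pm *.
  have aW : wprod w a s (n k0 - p + s) <= wprod w b s (n k0 - p + s).
    exact: (wprod_le admissible_gt0 w_nondecr).
  apply: le_trans (_ : sigma * modulus (seqcoord (y i) s) <= _); last first.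
    rewrite addr0 ComplexField.Normc.normcM modulus_real ger0_norm //.
    by rewrite ler_peMl // mulr_ge0 // modulus_ge0.
  case: eqP => [->|/eqP rm].
    (* For [r = m] block [k0] would return exactly [y] at parameter [b]; replacing [b] by [a]
       multiplies it by a ratio between [expR (- (C * tau))] and 1. *)
    rewrite pm mulrCA -[X in _ - X]mulr1 -mulrBr ComplexField.Normc.normcM
      mulrC.
    rewrite ler_wpM2r ?modulus_ge0 // -fmorphV -rmorphM -(rmorph1 (real_complex
      R)) -rmorphB.
    rewrite modulus_real ler0_norm ?subr_le0 ?ler_pdivrMr ?mul1r // opprB.
    apply: le_trans sig; rewrite lerD2l lerN2 ler_pdivlMr //.
    apply: (@wprod_lipschitz _ I w F C admissible_gt0 w_nondecr F_gt0 F_nondecr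
      C_gt0 f_lip _ _ _ _ (n k0)) => //.
    by rewrite leq_addl /=; move: nk0 sp; clear; lia.
  have mr' : (m < r)%N by rewrite ltn_neqAle eq_sym rm.
  rewrite subr0 ComplexField.Normc.normcM modulus_real modulusX gtr0_norm //.
  (* For [r > m] at least one extra factor of modulus at most [sigma <= 1] is available. *)
  have h1 : modulus v ^+ r <= sigma * modulus v ^+ m.
    apply: le_trans (_ : modulus v ^+ m.+1 <= _).
      by apply: ler_wiXn2l => //; [exact: modulus_ge0 | exact: le_trans (psig
        _) sig1].
    by rewrite exprS ler_wpM2r ?psig // exprn_ge0 // modulus_ge0.
  apply: le_trans (ler_wpM2l (ltW Wa) h1) _.
  rewrite mulrCA ler_wpM2l // -modulusX pm ComplexField.Normc.normcM.
  rewrite ComplexField.Normc.normcV modulus_real gtr0_norm // mulrCA.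
  by rewrite ler_piMr ?modulus_ge0 // ler_pdivrMr // mul1r.
have -> : (if r == m then seqcoord (y i) s else 0) = 0 by rewrite yp // if_same.
rewrite subr0 yp // mulr0 add0r.
have [[j [l [hj lp sE]]]|hs] := pselect (exists j l,
    [/\ (1 <= j <= nq)%N, (l <= p)%N & (n j - p + l = n k0 - p + s)%N]);
      last first.
  rewrite perturbation_out; first by rewrite expr0n eqn0Ngt r1 mulr0
    ComplexField.Normc.normc0 mulr_ge0 ?modulus_ge0 // (le_trans _ M1).
  by move=> j l hj lp E; apply: hs; exists j, l.
have k0j : (k0 < j)%N.
  rewrite ltnNge; apply/negP; rewrite leq_eqVlt => /orP[/eqP jk|jk].
    by move: sE; rewrite jk => /addnI E; move: ps; rewrite -E ltnNge lp.
  have /andP[j1 _] := hj; have /andP[_ k0q] := hk0.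
  have := separated_indices n_sep j1 (j := k0); rewrite jk k0q => /(_ isT).
  by move: nk0 (n_min hj) lp ps sE; clear; lia.
have hj' : (k0 < j <= nq)%N by rewrite k0j; case/andP: hj.
have [_ nj] := later_index hk0 hj'.
have sE' : (n j - n k0 + l)%N = s by move: nj nk0 lp sE; clear; lia.
rewrite -sE -[in seqcoord (Hsum i k0) s]sE' Hsum_in // sE'.
rewrite ComplexField.Normc.normcM !modulus_real modulusX -/b.
have Ij := lam_I hj i; set g := lam j i in Ij *.
have W1 l' n' := wp_gt0 l' n' Ia; have W2 l' n' := wp_gt0 l' n' Ib.
have W3 l' n' := wp_gt0 l' n' Ij.
rewrite gtr0_norm // [in leRHS]gtr0_norm ?divr_gt0 //.
apply: le_trans (ler_wpM2l (ltW (W1 _ _)) (powm _)) _.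
rewrite -modulusX (perturbation_in i hj lp) -/g ComplexField.Normc.normcM.
rewrite ComplexField.Normc.normcV modulus_real gtr0_norm //.
set t := (n j - p + l)%N.
have st : (s <= t <= n j + l)%N by rewrite /t -sE'; move: nj nk0 lp; clear; lia.
have lt : (l <= t <= n j + l)%N by rewrite /t; move: nj nk0 lp; clear; lia.
have tp : (n j + l <= t + p)%N by rewrite /t; move: nj nk0 lp; clear; lia.
(* The products in (iii) run up to [n j + l], those of the orbit only up to [t = n j - p + l]; the
   ratio of the [p] additional factors is at least [c ^+ p]. *)
rewrite (wprod_cat w b st) (wprod_cat w g lt).
have h1 : wprod w a s t <= wprod w b s t by exact: (wprod_le admissible_gt0
  w_nondecr).
have h2 := wprod_comparable admissible_gt0 c_gt0 w_ratio Ib Ij tp.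
have h3 : modulus (seqcoord (y i) l) / wprod w g l t <= Y / wprod w g l t.
  by rewrite ler_wpM2r // invr_ge0 ltW.
apply: le_trans (_ : wprod w b s t * (Y / wprod w g l t) <= _).
  apply: ler_pM => //; first exact: ltW.
  by rewrite divr_ge0 ?modulus_ge0 // ltW.
have -> : Y / c ^+ p * (wprod w b s t * wprod w b t (n j + l) /
     (wprod w g l t * wprod w g t (n j + l))) =
   wprod w b s t * (Y / wprod w g l t) * (wprod w b t (n j +
     l) / (c ^+ p * wprod w g t (n j + l))).
  by field; rewrite !gt_eqF.
rewrite ler_peMr //.
  by rewrite mulr_ge0 ?(ltW (W2 _ _)) // divr_ge0 ?(ltW (W3 _ _)) // (le_trans
    ler01).
by rewrite ler_pdivlMr ?mul1r // mulr_gt0.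
Qed.

End Perturbation.
Let sum_le_const (n : nat) (f : nat -> R) (b : R) :
  (forall l, (l <= n)%N -> f l <= b / n.+1%:R) -> \sum_(0 <= l < n.+1) f l <= b.
Proof.
move=> hf; apply: le_trans (_ : \sum_(0 <= l < n.+1) b / n.+1%:R <= _).
  rewrite big_nat_cond [leRHS]big_nat_cond;
    apply: ler_sum => l /andP[/andP[_ ln] _].
  exact: hf.
by rewrite sumr_const_nat subn0 -[leLHS]mulr_natr divfK // pnatr_eq0.
Qed.

Lemma covering_dense m t (K : set ('I_d -> R)) (y x : 'I_d -> X) p q (eta : R) :
  (1 <= m)%N -> K `<=` Lam -> 0 < eta ->
  (forall i k, (p < k)%N -> seqcoord (y i) k = 0) ->
  (forall i k, (p < k)%N -> seqcoord (x i) k = 0) ->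
  (forall tau N eps, 0 < tau -> (1 <= N)%N -> 0 < eps ->
    covering m tau N eps K) ->
  exists u, (forall i, seminorm q (u i - x i) < eta) /\
    forall mu, K mu -> hits w u m t y mu.
Proof.
move=> m1 KL eta0 yp xp hcov.
have [a0 Ia0] := I_neq0; have [iota [iotaP w_iota]] := weights_lower_bound.
have sum_ge q' i : seminorm q' (y i) <= \sum_(j < d) seminorm q' (y j).
  by rewrite (bigD1 i) //= lerDl sumr_ge0 // => j _; exact: seminorm_ge0.
pose Y := 1 + \sum_(i < d) seminorm q0 (y i).
have Y1 : 1 <= Y by rewrite lerDl sumr_ge0 // => j _; exact: seminorm_ge0.
have hY i l : modulus (seqcoord (y i) l) <= Y.
  apply: le_trans (modulus_seqcoord_le e_unit norm_q0 (y i) l (leqnn q0)) _.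
  by apply: le_trans (sum_ge q0 i) _; rewrite lerDr.
have p2 : 0 < (2^-1 : R) ^+ t by rewrite exprn_gt0 // invr_gt0.
have [Q [delta [d0 hdom]]] := domination e_unit norm_q0 e_basis t (Y / c ^+ p)
  p2.
have d20 : 0 < delta / 2 by rewrite divr_gt0.
pose S := 1 + \sum_(i < d) seminorm Q (y i).
have S0 : 0 < S by rewrite ltr_pwDl // sumr_ge0 // => j _; exact: seminorm_ge0.
(* With this choice [sigma * y] uses at most half of [delta]; the other half is left for the vectors
   of (iii). *)
pose sigma := Num.min 1 (delta / 2 / S).
have sig0 : 0 < sigma by rewrite lt_min ltr01 divr_gt0.
have sig1 : sigma <= 1 by rewrite ge_min lexx.
have sigQ i : sigma * seminorm Q (y i) < delta / 2.
  apply: lt_le_trans (_ : sigma * S <= _).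
    by rewrite ltr_pM2l // (le_lt_trans (sum_ge Q i)) // ltrDr.
  by rewrite -ler_pdivlMr // ge_min lexx orbT.
pose q' := maxn q q0; pose eta' := Num.min eta sigma.
have eta'0 : 0 < eta' by rewrite lt_min eta0.
(* This constant must be known before the covering is chosen, which is why [perturbation_dominated]
   refers to a fixed [a0] rather than to the [lam k]. *)
pose M2 := Y * ((iota ^+ p)^-1 +
  ((c ^+ p)^-1 * \sum_(0 <= l < p.+1) wprod w a0 0 l) * (c ^+ p)^-1).
have [Q2 [delta2 [d2' hdom2]]] := domination e_unit norm_q0 e_basis q' M2 eta'0.
have [|Q3 [delta3 [d30 hB]]] := @iter_wshift_small_upto _ _ _ (w_adm Ia0) p Q2
  (delta2 / 2 / p.+1%:R).
  by rewrite !divr_gt0.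
have [eps2 [eps20 heps2]] := Fnorm_small_seminorm Fnorm_X Q3 d30.
have [|eps3 [eps30 heps3]] := @Fnorm_small_seminorm _ _ _ Fnorm_X Q (delta / 2
  / p.+1%:R).
  by rewrite !divr_gt0.
(* With [tau = sigma / C] the parameter error is at most [1 - expR (- sigma) <= sigma]. The gap
   [2 * p + 1] keeps the blocks apart and makes the first one, which starts at [n 1 - p], lie beyond
   the support of [x]. *)
have [||| nq [n [lam [[nq1 [n1 nsep] lamI] [cov iiP iiiP]]]]] :=
  hcov (sigma / C) (2 * p + 1)%N (Num.min eps2 eps3).
- by rewrite divr_gt0.
- by rewrite addn1.
- by rewrite lt_min eps20.
have /choice[h hP] : forall il : 'I_d * nat, exists h : R[i],
  h ^+ m = seqcoord (y il.1) il.2.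
  by move=> il; exact: complex_root.
pose hh i l := h (i, l).
have hhP i l : hh i l ^+ m = seqcoord (y i) l by exact: hP (i, l).
pose Z i := perturbation m p nq n lam hh i.
have Zsmall i : seminorm q' (Z i) < eta'.
  pose G := \sum_(1 <= k < nq.+1)
    (1 / wprod w (lam k i) 0 (n k) `^ (1 / m%:R))%:C *: e (n k).
  apply: (hdom2 _ (\sum_(0 <= j < p.+1) iter j (wshift (w a0)) G)) => [s|].
    exact: (perturbation_dominated m1 n1 nsep lamI hhP s Y1 Ia0 iotaP w_iota
      (hY i)).
  apply: le_lt_trans (seminorm_sum _ _ _ _) _.
  apply: le_lt_trans (_ : delta2 / 2 < _); last by lra.
  apply: sum_le_const => j jp; apply/ltW/hB => //; apply: heps2.
  by apply: lt_le_trans (iiP i) _; rewrite ge_min lexx.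
exists (fun i => x i + Z i); split.
  move=> i; rewrite [x i + _]addrC addrK.
  apply: le_lt_trans (seminorm_le _ (leq_maxl q q0)) _.
  by apply: lt_le_trans (Zsmall i) _; rewrite ge_min lexx.
move=> mu Kmu; have [k0 /= hk0 box] := cov _ Kmu.
have muI i : I (mu i) by exact: Lam_I (KL _ Kmu) i.
have psig i k : modulus (seqcoord (Z i) k) <= sigma.
  apply: le_trans (modulus_seqcoord_le e_unit norm_q0 (Z i) k (leq_maxr q q0))
    _.
  by apply: le_trans (ltW (Zsmall i)) _; rewrite ge_min lexx orbT.
have key i r : (m <= r)%N -> seminorm t (iter (n k0 - p) (wshift (w (mu i)))
    (seqpow (x i + Z i) r) - (if r == m then y i else 0)) < 2^-1 ^+ t.
  move=> mr; pose H := \sum_(0 <= l < p.+1) \sum_(k0.+1 <= j < nq.+1)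
      (wprod w (lam k0 i) (n j - n k0 + l) (n j + l) /
       wprod w (lam j i) l (n j + l))%:C *: e (n j - n k0 + l)%N.
  apply: (hdom _ (sigma%:C *: y i + H)) => [s|].
    apply: (perturbation_orbit m1 n1 nsep lamI hhP s hk0 (muI i) _ (box i) _
      sig1 Y1 (hY i) (xp i) (yp i) (psig i) mr).
      by rewrite divr_ge0 ?ltW.
    rewrite mulrC divfK ?gt_eqF //; have := expR_ge1Dx (- sigma); lra.
  apply: le_lt_trans (seminorm_triangle _ _ _) _.
  rewrite seminormZ modulus_real gtr0_norm //.
  suff : seminorm Q H <= delta / 2 by have := sigQ i; lra.
  apply: le_trans (seminorm_sum _ _ _ _) _.
  apply: sum_le_const => l lp; apply/ltW/heps3.
  apply: lt_le_trans (iiiP k0 hk0 i l _) _; last by rewrite ge_min lexx orbT.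
  by move: lp; clear; lia.
have nk0 : (2 * p + 1 <= n k0)%N.
  have /andP[k01 k0q] := hk0; move: k01; rewrite leq_eqVlt => /orP[/eqP <-
    //|k1].
  by have := separated_indices nsep (leqnn 1%N) (j := k0);
    rewrite k1 k0q => /(_ isT); clear; lia.
exists (n k0 - p)%N; split.
- by move: nk0; clear; lia.
- by move=> i; have := key i m (leqnn m);
    rewrite eqxx iter_wshift_prod pow_prodE.
- move=> r /andP[mr _] i; have := key i r (ltnW mr).
  by rewrite gtn_eqF // subr0 iter_wshift_prod pow_prodE.
Qed.

End CoveringCondition.

(** * Hitting times *)

Section HitTimes.
Variables (R : realType) (X : frechetSequenceAlgebraType R) (e : nat -> X).
Variables (q0 d : nat) (w : R -> nat -> R) (lam : 'I_d -> R) (v : 'I_d -> X).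
Hypothesis e_unit : unit_vectors e.
Hypothesis norm_q0 : forall x : X, seminorm q0 x = 0 -> x = 0.
Hypothesis e_basis : unconditional_basis e.
Hypothesis w_adm : forall i, admissible X (w (lam i)).
Implicit Types (y z : 'I_d -> X).

Local Notation T := (wshift_prod w lam).
Local Notation W i l n := (wprod w (lam i) l n).

Let W_gt0 i l n : 0 < W i l n := prod_weight_gt0 (w_adm i) l n.+1.

(** Weighted forward translate: a preimage of [y] under the [a]-th iterate when [y] is supported in
    [0, p]. *)
Definition forward p a y i : X :=
  \sum_(0 <= k < p.+1) (seqcoord (y i) k / (W i k (a + k))%:C) *: e (a + k)%N.

Let add_inj a p : {in index_iota 0 p.+1 &, injective (addn a)}.
Proof. by move=> k k' _ _ /addnI. Qed.

Lemma forward_in p a y i k : (k <= p)%N ->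
  seqcoord (forward p a y i) (a + k)%N = seqcoord (y i) k / (W i k (a + k))%:C.
Proof.
move=> kp; have kin : k \in index_iota 0 p.+1 by rewrite mem_index_iota ltnS.
exact: (seqcoord_sparse_in e_unit _ (iota_uniq _ _) (@add_inj a p) kin).
Qed.

Lemma forward_out p a y i s : (s < a)%N || (a + p < s)%N ->
  seqcoord (forward p a y i) s = 0.
Proof.
move=> hs; apply: (seqcoord_sparse_out e_unit) => k;
  rewrite mem_index_iota ltnS.
by move: hs; clear; lia.
Qed.

Lemma iter_forward p a b y i : (b <= a)%N ->
  iter b (wshift (w (lam i))) (forward p a y i) = forward p (a - b) y i.
Proof.
move=> ba; apply: seqcoord_ext => s; rewrite (seqcoord_iter_wshift (w_adm i)).
have [[k [kp sE]]|hs] := pselect (exists k, (k <= p)%N /\ (a - b + k)%N = s);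
  last first.
  have hs' : (s < a - b)%N || (a - b + p < s)%N.
    by apply: contra_notT hs => h; exists (s - (a - b))%N; move: h; clear; lia.
  rewrite !forward_out ?mulr0 //; move: hs' ba; clear; lia.
have bs : (b + s = a + k)%N by move: ba sE; clear; lia.
rewrite bs forward_in // -sE forward_in //.
have Wcat : W i k (a + k) = W i k (a - b + k) * W i (a - b + k) (a + k).
  by apply: wprod_cat; move: ba; clear; lia.
rewrite -/(W i (a - b + k) (a + k)) Wcat rmorphM.
by field; rewrite !fmorph_eq0 !gt_eqF.
Qed.

Lemma forward0 p y i : (forall k, (p < k)%N -> seqcoord (y i) k = 0) ->
  forward p 0 y i = y i.
Proof.
move=> yp; apply: seqcoord_ext => s; have [sp|ps] := leqP s p.
  by rewrite -[s in LHS]add0n forward_in // /wprod big_geq ?add0n // rmorph1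
    divr1.
by rewrite forward_out ?yp // add0n ps orbT.
Qed.

Let uniform_small L q (eta : R) : 0 < eta ->
  exists Q (delta : R), 0 < delta /\ forall x : X, seminorm Q x < delta ->
    forall i j, (j <= L)%N -> seminorm q (iter j (wshift (w (lam i))) x) < eta.
Proof.
move=> eta0.
have /choice[Q QP] := fun i => iter_wshift_small_upto (w_adm i) L q eta0.
have /choice[delta dP] := QP.
exists (\max_(i < d) Q i), (\big[Num.min/1]_(i < d) delta i); split.
  by elim/big_ind: _ => [|a b a0 b0|i _]; rewrite ?lt_min ?a0 //; case: (dP i).
move=> x hx i j jL; have [_ h] := dP i; apply: h jL.
apply: le_lt_trans (seminorm_le x (leq_bigmax i)) _.
by apply: lt_le_trans hx _; exact: bigmin_le.
Qed.

Hypothesis v_hyp : hypercyclic T v.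

(* Aiming at a preimage under [T ^ n0] gives hitting times beyond [n0]. *)
Let hit_late p y q (eps : R) n0 :
  (forall i k, (p < k)%N -> seqcoord (y i) k = 0) -> 0 < eps ->
  exists n, (n0 <= n)%N /\ forall i, seminorm q (iter n T v i - y i) < eps.
Proof.
move=> yp e0; have [Q [delta [d0 hd]]] := uniform_small n0 q e0.
have [n [_ hn]] := hypercyclic_hit v_hyp (forward p n0 y) Q d0.
exists (n0 + n)%N; split=> [|i]; first exact: leq_addr.
have := hd _ (hn i) i n0 (leqnn n0).
rewrite (iter_wshiftB (w_adm i)) iter_forward // subnn forward0; last exact: yp.
by rewrite !iter_wshift_prod iterD.
Qed.

(** A late visit of the orbit near [e 0] at time [n] bounds [1 / W i 0 n] by twice the modulus of
    the [n]-th coordinate of [v i], and the terms of the expansion of [v i] tend to 0. Applying at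
    most [L] shifts to the small vector obtained at [n] fills the window below [n]. *)
Let small_window Q (delta : R) L : 0 < delta ->
  exists n0, (L <= n0)%N /\ forall i j, (n0 - L <= j <= n0)%N ->
    seminorm Q ((W i 0 j)^-1%:C *: e j) < delta.
Proof.
move=> d0; have [Q' [delta' [d'0 hd]]] := uniform_small L Q d0.
have d40 : 0 < delta' / 4 by rewrite divr_gt0.
have /choice[N hN] := fun i => basis_approx e_unit norm_q0 e_basis (v i) Q' d40.
have h2 : 0 < 2^-1 :> R by rewrite invr_gt0.
have e0P i k : (0 < k)%N -> seqcoord ((fun _ : 'I_d => e 0) i) k = 0.
  by move=> k0; rewrite e_unit gtn_eqF.
have [n [nL hn]] := @hit_late 0 (fun=> e 0) q0 _ (maxn L (\max_(i <
  d) N i)) e0P h2.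
have Ln : (L <= n)%N by apply: leq_trans nL; exact: leq_maxl.
exists n; split=> // i j /andP[nj jn].
have Wn := W_gt0 i 0 n.
have inv_le : (W i 0 n)^-1 <= 2 * modulus (seqcoord (v i) n).
  have := modulus_seqcoord_le e_unit norm_q0 (iter n T v i - e 0) 0 (leqnn q0).
  rewrite seqcoordB e_unit iter_wshift_prod (seqcoord_iter_wshift (w_adm i))
    addn0.
  rewrite -/(W i 0 n) => h; have hni := hn i; rewrite iter_wshift_prod in hni.
  have {}h : modulus ((W i 0 n)%:C * seqcoord (v i) n - 1) < 2^-1 :=
    le_lt_trans h hni.
  rewrite -(ler_pM2r Wn) mulVf ?gt_eqF //.
  have := modulusD (1 - (W i 0 n)%:C * seqcoord (v i) n) ((W i 0 n)%:C *
    seqcoord (v i) n).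
  rewrite subrK ComplexField.Normc.normc1 modulus_distC => h1.
  rewrite ComplexField.Normc.normcM modulus_real gtr0_norm // in h1.
  by move: h h1; lra.
have term : seminorm Q' (seqcoord (v i) n *: e n) < delta' / 2.
  have Nn : (N i <= n)%N.
    by apply: leq_trans nL; rewrite leq_max (leq_bigmax (F := N) i) orbT.
  have := hN i n Nn; have := hN i n.+1 (leqW Nn).
  rewrite big_nat_recr //=; set s := \sum_(0 <= k < n) _ => h3 h4.
  have := seminormB Q' (s + seqcoord (v i) n *: e n) (v i) s.
  rewrite addrAC subrr add0r [seminorm Q' (v i - s)]seminorm_distC;
    move: h3 h4; lra.
have sn : seminorm Q' ((W i 0 n)^-1%:C *: e n) < delta'.
  apply: le_lt_trans (_ : 2 * seminorm Q' (seqcoord (v i) n *: e n) < _);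
    last by lra.
  rewrite !seminormZ modulus_real gtr0_norm ?invr_gt0 // mulrA.
  by rewrite ler_wpM2r ?seminorm_ge0.
have -> : (W i 0 j)^-1%:C *: e j = iter (n - j) (wshift (w (lam i))) ((W i 0
  n)^-1%:C *: e n).
  apply: seqcoord_ext => s; rewrite (seqcoord_iter_wshift (w_adm i)) !seqcoordZ
    !e_unit.
  have -> : ((n - j + s)%N == n) = (s == j) by move: jn; clear; lia.
  case: eqP => [->|]; last by rewrite !mulr0.
  rewrite !mulr1 subnK // -/(W i j n) -rmorphM.
  have -> : W i 0 n = W i 0 j * W i j n by exact: wprod_cat.
  by congr (_%:C); rewrite invfM mulrCA divff ?mulr1 // gt_eqF.
by apply: hd => //; move: nj; clear; lia.
Qed.

Let residue M D r : (0 < D)%N -> (D <= M)%N ->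
  exists a, (M - D < a <= M)%N /\ a = r %[mod D].
Proof.
move=> D0 DM; exists ((M - r %% D) %/ D * D + r %% D)%N.
have rD := ltn_pmod r D0; split; last by rewrite modnMDl modn_mod.
have := divn_eq (M - r %% D) D; have := ltn_pmod (M - r %% D) D0.
by move: rD DM D0; clear; lia.
Qed.

(** Writing [1 / W i k (a + k)] as [W i 0 k / W i 0 (a + k)] leaves a factor that does not depend on
    [a], so [delta] is uniform in [a]. *)
Let forward_small y p q (eps : R) : 0 < eps -> exists delta, 0 < delta /\
  forall a, (forall i j, (a <= j <= a + p)%N ->
    seminorm q ((W i 0 j)^-1%:C *: e j) < delta) ->
  forall i, seminorm q (forward p a y i) < eps.
Proof.
move=> e0; pose B := 1 + \sum_(i < d) \sum_(0 <= k <
  p.+1) modulus (seqcoord (y i) k) * W i 0 k.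
have B_i i : 0 <= \sum_(0 <= k < p.+1) modulus (seqcoord (y i) k) * W i 0 k.
  by apply: sumr_ge0 => k _; rewrite mulr_ge0 ?modulus_ge0 // ltW.
have B0 : 0 < B by rewrite ltr_pwDl // sumr_ge0.
exists (eps / B); split; first by rewrite divr_gt0.
move=> a ha i; apply: le_lt_trans (seminorm_sum _ _ _ _) _.
apply: le_lt_trans (_ : (\sum_(0 <= k < p.+1) modulus (seqcoord (y i) k) * W i
  0 k) * (eps / B) < _).
  rewrite mulr_suml big_nat_cond [leRHS]big_nat_cond;
    apply: ler_sum => k /andP[/andP[_ kp] _].
  have -> : (seqcoord (y i) k / (W i k (a + k))%:C) *: e (a + k)%N =
      (seqcoord (y i) k * (W i 0 k)%:C) *: ((W i 0 (a + k))^-1%:C *: e (a +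
        k)%N).
    rewrite scalerA; congr (_ *: _).
    have -> : W i 0 (a + k) = W i 0 k * W i k (a + k) by apply: wprod_cat;
      rewrite leq_addl.
    rewrite fmorphV rmorphM; field.
    by rewrite !fmorph_eq0 !gt_eqF.
  rewrite seminormZ ComplexField.Normc.normcM modulus_real gtr0_norm //.
  apply: ler_wpM2l; first by rewrite mulr_ge0 ?modulus_ge0 // ltW.
  by apply/ltW/ha; rewrite leq_addr leq_add2l -ltnS.
rewrite mulrA ltr_pdivrMr // mulrC ltr_pM2l // /B.
apply: le_lt_trans (_ : \sum_(j < d) \sum_(0 <= k <
  p.+1) modulus (seqcoord (y j) k) * W j 0 k < _); last by rewrite ltrDr.
by rewrite [leRHS](bigD1 i) //= lerDl sumr_ge0.
Qed.

(* A substitute for Ansari's theorem: approaching [z] at time [n] makes one of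
   the times [n + a r] a multiple of [D] at which the orbit is near [y]. *)
Let all_residues D p y q (eps : R) s : (0 < D)%N ->
  (forall i k, (p < k)%N -> seqcoord (y i) k = 0) -> 0 < eps ->
  exists z pz (a : nat -> nat), (forall i k, (pz < k)%N ->
    seqcoord (z i) k = 0) /\
    forall r, (r < s)%N -> a r = r %[mod D] /\
      forall i, seminorm q (iter (a r) (wshift (w (lam i))) (z i) - y i) < eps.
Proof.
move=> D0 yp; elim: s eps => [|s IH] eps e0.
  by exists (fun=> 0), 0%N, id; split=> // i k _; rewrite seqcoord0.
have e20 : 0 < eps / 2 by rewrite divr_gt0.
have [z [pz [a [zp za]]]] := IH _ e20.
have [delta [d0 hfw]] := forward_small y p q e20.
pose A := \max_(r < s) a r.
have aA r : (r < s)%N -> (a r <= A)%N.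
  by move=> rs; exact: (leq_bigmax (F := fun r : 'I_s => a r) (Ordinal rs)).
(* The new time [a'] is taken within [D] of [n0 - p]. The window then contains the supports of all
   translates by [a' - a r], and [a'] exceeds [pz], so that [z] has vanished by time [a']. *)
have [n0 [Ln hn0]] := small_window q (A + p + D + pz + 1)%N d0.
have [|a' [ha' ra']] := @residue (n0 - p)%N D s D0; first by move: Ln; clear;
  lia.
have pza : (pz < a')%N by move: Ln ha'; clear; lia.
exists (fun i => z i + forward p a' y i), (maxn pz (a' + p)),
  (fun r => if r == s then a' else a r).
split.
  move=> i k; rewrite gtn_max => /andP[h1 h2].
  by rewrite seqcoordD zp // forward_out ?addr0 // h2 orbT.
move=> r; rewrite ltnS leq_eqVlt => /orP[/eqP ->|rs].
  rewrite eqxx; split=> // i; rewrite (iter_wshiftD (w_adm i)) iter_forward //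
    subnn.
  rewrite forward0; last exact: yp.
  have -> : iter a' (wshift (w (lam i))) (z i) = 0.
    apply: seqcoord_ext => k; rewrite (seqcoord_iter_wshift (w_adm i)) zp
      ?mulr0 ?seqcoord0 //.
    by apply: leq_trans pza _; exact: leq_addr.
  by rewrite add0r subrr seminorm0.
rewrite ltn_eqF //; have [ra hr] := za r rs; split=> // i.
have ara' : (a r <= a')%N by move: (aA r rs) Ln ha'; clear; lia.
rewrite (iter_wshiftD (w_adm i)) iter_forward // addrAC.
apply: le_lt_trans (seminorm_triangle _ _ _) _.
suff : seminorm q (forward p (a' - a r) y i) < eps / 2 by have := hr i; lra.
apply: hfw => i' j hj; apply: hn0.
by move: (aA r rs) Ln ha' hj; clear; lia.
Qed.

Lemma hit_multiple D p y q (eps : R) N : (0 < D)%N ->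
  (forall i k, (p < k)%N -> seqcoord (y i) k = 0) -> 0 < eps ->
  exists n, [/\ (N <= n)%N, (D %| n)%N & forall i,
    seminorm q (iter n T v i - y i) < eps].
Proof.
move=> D0 yp e0; have e20 : 0 < eps / 2 by rewrite divr_gt0.
have [z [pz [a [zp za]]]] := all_residues q D D0 yp e20.
have [Q [delta [d0 hd]]] := uniform_small (\max_(r < D) a r) q e20.
have [n [Nn hn]] := hit_late Q N zp d0.
(* The residue that completes [n] to a multiple of [D]. *)
pose r := ((D - n %% D) %% D)%N; have rD : (r < D)%N by exact: ltn_pmod.
have [ra hr] := za r rD; exists (a r + n)%N; split.
- exact: leq_trans Nn (leq_addl _ _).
- rewrite /dvdn -modnDml ra modnDml -modnDmr /r modnDml subnK ?modnn //.
  by rewrite ltnW // ltn_pmod.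
move=> i; rewrite iter_wshift_prod iterD.
apply: le_lt_trans (seminormB _ _ (iter (a r) (wshift (w (lam i))) (z i)) _) _.
suff : seminorm q (iter (a r) (wshift (w (lam i))) (iter n (wshift (w (lam i)))
  (v i)) -
    iter (a r) (wshift (w (lam i))) (z i)) < eps / 2 by have := hr i; lra.
rewrite -(iter_wshiftB (w_adm i)); apply: hd.
  by have := hn i; rewrite iter_wshift_prod.
exact: (leq_bigmax (F := fun r : 'I_D => a r) (Ordinal rD)).
Qed.

End HitTimes.

(** * From common hypercyclicity to the covering condition *)

Section Necessity.
Variables (R : realType) (X : frechetSequenceAlgebraType R) (Fnorm : X -> R).
Variables (e : nat -> X) (I : set R) (d : nat) (Lam : set ('I_d -> R)).
Variables (w : R -> nat -> R) (F : nat -> R) (c : R) (q0 : nat).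
Hypothesis Fnorm_X : is_Fnorm Fnorm.
Hypothesis e_unit : unit_vectors e.
Hypothesis norm_q0 : forall x : X, seminorm q0 x = 0 -> x = 0.
Hypothesis e_basis : unconditional_basis e.
Hypothesis Lam_I : Lam `<=` [set lam | forall i, I (lam i)].
Hypothesis w_adm : forall a, I a -> admissible X (w a).
Hypothesis w_cont : continuous_family X I Lam w.
Hypothesis w_nondecr : forall n, (1 <= n)%N ->
  forall a b, I a -> I b -> a <= b -> w a n <= w b n.
Hypothesis F_gt0 : forall n, 0 < F n.
Hypothesis c_gt0 : 0 < c.
Hypothesis f_colip : forall n, (1 <= n)%N -> forall a b, I a -> I b ->
  c * F n * `|a - b| <=
  `|\sum_(1 <= k < n.+1) ln (w a k) - \sum_(1 <= k < n.+1) ln (w b k)|.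

Variables (v : 'I_d -> X) (y : 'I_d -> X) (K : set ('I_d -> R)).
Hypothesis K_compact : compact K.
Hypothesis K_Lam : K `<=` Lam.

Let wp_gt0 a l n : I a -> 0 < wprod w a l n.
Proof. by move=> Ia; exact: (prod_weight_gt0 (w_adm Ia)). Qed.

Definition return_set Q (delta : R) n : set ('I_d -> R) :=
  [set lam | K lam /\
     forall i, seminorm Q (iter n (wshift_prod w lam) v i - y i) <= delta].

(** Continuity in the parameter holds only within [Lam], so closedness is proved relative to [K]. *)
Lemma return_set_compact Q delta n : compact (return_set Q delta n).
Proof.
have -> : return_set Q delta n = K `&` closure (return_set Q delta n).
  apply/seteqP; split=> [lam Elam|lam [Klam cl]].
    by split; [exact: Elam.1 | exact: subset_closure].
  split=> // i; apply/ler_addgt0Pr => r r0.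
  have [U [Q' [delta' [nU d'0 hU]]]] :=
    iter_wshift_prod_continuous w_cont n v Q (K_Lam Klam) r0.
  have [mu [[Kmu Emu] Umu]] := cl _ nU.
  apply: le_trans (seminormB _ _ (iter n (wshift_prod w mu) v i) _) _.
  rewrite addrC; apply: lerD => //; rewrite seminorm_distC; apply: ltW.
  by apply: hU => //; [exact: K_Lam | move=> j; rewrite subrr seminorm0].
by apply: compact_closedI => //; exact: closed_closure.
Qed.

Lemma return_set_max Q delta n i : return_set Q delta n !=set0 ->
  exists mu, return_set Q delta n mu /\
    forall lam, return_set Q delta n lam -> lam i <= mu i.
Proof.
move=> E0.
have cproj : {within return_set Q delta n, continuous (fun lam : 'I_d ->
  R => lam i)}.
  by apply: continuous_subspaceT; exact: (@proj_continuous _ (fun=> R) i).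
have [mu /set_mem Emu hmu] := compact_EVT_max E0 (@return_set_compact Q delta
  n) cproj.
by exists mu; split=> // lam /mem_set; exact: hmu.
Qed.

Hypothesis v_hyp : common_hypercyclic Lam (wshift_prod w) v.

(** A visit within [delta / 2] remains a visit within [delta] for nearby parameters; compactness
    then bounds the times that are needed. *)
Lemma return_sets_cover p Q (delta : R) D N : (0 < D)%N -> 0 < delta ->
  (forall i k, (p < k)%N -> seqcoord (y i) k = 0) ->
  exists M, forall lam, K lam ->
    exists n, [/\ (n <= M)%N, (N <= n)%N, (D %| n)%N & return_set Q delta n
      lam].
Proof.
move=> D0 d0 yp; have d20 : 0 < delta / 2 by rewrite divr_gt0.
have /compact_near_coveringP/near_covering_withinP ncK := K_compact.
have [] := ncK nat \oo (fun M lam => exists n, [/\ (n <= M)%N, (N <= n)%N,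
  (D %| n)%N &
  return_set Q delta n lam]) _.
  move=> lam0 K0; have L0 := K_Lam K0.
  have [n [Nn Dn hn]] := hit_multiple e_unit norm_q0 e_basis
    (fun i => w_adm (Lam_I L0 i)) (v_hyp L0) Q N D0 yp d20.
  have [U [Q' [delta' [nU d'0 hU]]]] := iter_wshift_prod_continuous w_cont n v
    Q L0 d20.
  exists (U, [set M | (n <= M)%N]); first by split=> //=; exists n.
  move=> [lam M] [/= Ul nM] Kl; exists n; split=> //; split=> // i; apply: ltW.
  apply: le_lt_trans (seminormB _ _ (iter n (wshift_prod w lam0) v i) _) _.
  have := hU lam v Ul (K_Lam Kl) (fun j => _) i; have := hn i.
  suff : forall j, seminorm Q' (v j - v j) < delta' by move=> h h1 /(_ h); lra.
  by move=> j; rewrite subrr seminorm0.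
by move=> M _ /(_ M (leqnn M)) h; exists M.
Qed.

(* Two parameters returning at the same time nearly agree, since the product of
   the first [n] weights is expanding in the parameter. *)
Lemma return_set_small Q delta tau n lam mu i : (q0 <= Q)%N -> (1 <= n)%N ->
  seqcoord (y i) 0 = 1 -> 0 < delta <= 2^-1 -> 4 * delta <= c * tau ->
  return_set Q delta n lam -> return_set Q delta n mu -> lam i <= mu i ->
  mu i - tau / F n <= lam i.
Proof.
move=> qQ n1 y0 /andP[d0 d2] dtau [Kl hl] [Km hm] lm.
have Il := Lam_I (K_Lam Kl) i; have Im := Lam_I (K_Lam Km) i.
have Wl := wp_gt0 0 n Il; have Wm := wp_gt0 0 n Im.
have est (nu : 'I_d -> R) : I (nu i) ->
    seminorm Q (iter n (wshift_prod w nu) v i - y i) <= delta ->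
    1 - delta <= wprod w (nu i) 0 n * modulus (seqcoord (v i) n) <= 1 + delta.
  move=> Inu h.
  have := le_trans (modulus_seqcoord_le e_unit norm_q0 _ 0 qQ) h.
  rewrite seqcoordB y0 iter_wshift_prod (seqcoord_iter_wshift (w_adm Inu))
    addn0.
  rewrite -/(wprod w (nu i) 0 n); set z := (_ * seqcoord (v i) n) => hz.
  have -> : wprod w (nu i) 0 n * modulus (seqcoord (v i) n) = modulus z.
    by rewrite ComplexField.Normc.normcM modulus_real gtr0_norm ?wp_gt0.
  have := modulusD (1 - z) z; rewrite subrK ComplexField.Normc.normc1
    modulus_distC.
  have := modulusD (z - 1) 1; rewrite subrK ComplexField.Normc.normc1.
  by move=> h1 h2; apply/andP; split; move: hz h1 h2; lra.
have /andP[l1 _] := est lam Il (hl i); have /andP[_ m2] := est mu Im (hm i).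
have v0 : 0 < modulus (seqcoord (v i) n).
  by rewrite -(pmulr_rgt0 _ Wl); apply: lt_le_trans l1; lra.
(* For [delta <= 1/2] and [4 * delta <= c * tau] one has [1 + delta <= (1 + c * tau) * (1 - delta)],
   which explains the constraints on [delta]. *)
have ratio : wprod w (mu i) 0 n <= (1 + c * tau) * wprod w (lam i) 0 n.
  rewrite -(ler_pM2r v0); apply: le_trans m2 _; rewrite -mulrA.
  apply: le_trans (_ : (1 + c * tau) * (1 - delta) <= _); last first.
    by apply: ler_wpM2l => //; lra.
  by nra.
have adm_gt0 := admissible_gt0 w_adm.
have := f_colip n1 Im Il; rewrite ger0_norm ?subr_ge0 //.
rewrite ger0_norm; last first.
  by rewrite subr_ge0 -ler_expR -!(wprod_expR adm_gt0) //;
    exact: (wprod_le adm_gt0 w_nondecr).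
move=> h; have h2 : \sum_(1 <= k < n.+1) ln (w (mu i) k) - \sum_(1 <= k <
  n.+1) ln (w (lam i) k) <= c * tau.
  rewrite -ler_expR expRD expRN -!(wprod_expR adm_gt0) // ler_pdivrMr //.
  by apply: le_trans ratio _; rewrite ler_wpM2r ?expR_ge1Dx // ltW.
have := le_trans h h2; rewrite -mulrA ler_pM2l // mulrC -ler_pdivlMr //; lra.
Qed.

(** At position [l] the orbit is within 1/2 of 1, so the weight product times the modulus of the
    coordinate of [v] is at least 1/2. *)
Lemma return_set_inverse Q delta n lam i l N : (q0 <= Q)%N -> delta <= 2^-1 ->
  (forall k, seqcoord (y i) k = (k <= N)%:R) -> (l <= N)%N ->
  return_set Q delta n lam ->
  (wprod w (lam i) l (n + l))^-1 <= 2 * modulus (seqcoord (v i) (n + l)%N).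
Proof.
move=> qQ d2 yN lN [Kl hl]; have Il := Lam_I (K_Lam Kl) i.
have := le_trans (modulus_seqcoord_le e_unit norm_q0 _ l qQ) (hl i).
rewrite seqcoordB yN lN iter_wshift_prod (seqcoord_iter_wshift (w_adm Il)).
rewrite -/(wprod w (lam i) l (n + l)); have Wl := wp_gt0 l (n + l) Il.
set z := (_ * seqcoord (v i) _) => h.
have {}h : modulus (z - 1) <= delta := h.
rewrite -(ler_pM2r Wl) mulVf ?gt_eqF //.
have := modulusD (1 - z) z; rewrite subrK ComplexField.Normc.normc1
  modulus_distC.
rewrite [modulus z]ComplexField.Normc.normcM modulus_real gtr0_norm //.
by move: h; lra.
Qed.

Lemma covering_of_power m tau N eps (u : 'I_d -> X) : v = pow_prod u m ->
  (forall i k, seqcoord (y i) k = (k <= N)%:R) ->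
  (1 <= m)%N -> 0 < tau -> (1 <= N)%N -> 0 < eps -> K !=set0 ->
  covering Fnorm e I w F m tau N eps K.
Proof.
move=> vE yN m1 tau0 N1 eps0 [kap Kkap].
have [Qf [df [df0 hF]]] := seminorm_small_Fnorm Fnorm_X eps0.
have [Q1 [d1 [d10 hdom]]] := domination e_unit norm_q0 e_basis Qf 2 df0.
pose delta := Num.min (d1 / 2) (Num.min 2^-1 (c * tau / 4)).
have ct0 : 0 < c * tau / 4 by rewrite divr_gt0 // mulr_gt0.
have delta0 : 0 < delta by rewrite !lt_min ct0 invr_gt0 divr_gt0 // ltr0n.
have delta1 : delta < d1 by apply: le_lt_trans (_ : d1 / 2 < _);
  [rewrite ge_min lexx | lra].
have delta2 : delta <= 2^-1 by rewrite /delta !ge_min lexx orbT.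
have deltat : 4 * delta <= c * tau.
  have : delta <= c * tau / 4 by rewrite /delta !ge_min lexx !orbT.
  lra.
pose Q := maxn Q1 q0; have qQ : (q0 <= Q)%N by exact: leq_maxr.
have /choice[nu hnu] := fun i => basis_approx e_unit norm_q0 e_basis (u i) Q1
  d10.
pose N' := maxn N (\max_(i < d) nu i).
have nuN i : (nu i <= N')%N by rewrite leq_max (leq_bigmax (F := nu) i) orbT.
have yp i k : (N < k)%N -> seqcoord (y i) k = 0 by move=> Nk;
  rewrite yN leqNgt Nk.
(* Distinct multiples of [N + 1] are automatically separated by more than [N]; times beyond [N']
   make (ii) involve only a small tail of each [u i]. *)
have [M hM] := return_sets_cover Q N' (ltn0Sn N) delta0 yp.
pose E n := return_set Q delta n.
pose ns := [seq n <- iota 0 M.+1 | [&& (N' <= n)%N, (N.+1 %| n)%N & `[<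
  E n !=set0 >]]].
have ns_sorted : sorted ltn ns by apply: sorted_filter;
  [exact: ltn_trans | exact: iota_ltn_sorted].
have mem_ns n : n \in ns -> [/\ (N' <= n)%N, (N.+1 %| n)%N & E n !=set0].
  by rewrite mem_filter => /andP[/and3P[h1 h2 /asboolP h3] _].
have in_ns lam : K lam -> exists n, n \in ns /\ E n lam.
  move=> /hM[n [nM Nn Dn En]]; exists n; split=> //.
  rewrite mem_filter Nn Dn mem_iota ltnS nM /= andbT; apply/asboolP;
    by exists lam.
have /choice[mu hmu] : forall ni : nat * 'I_d, exists mu, E ni.1 !=set0 ->
    E ni.1 mu /\ forall lam, E ni.1 lam -> lam ni.2 <= mu ni.2.
  move=> [n i]; have [h|h] := pselect (E n !=set0); last by exists kap.
  by have [mu hmu] := return_set_max i h; exists mu.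
(* The corner takes its [i]-th coordinate from a return point maximizing that coordinate, so it need
   not itself be a return point. As (ii) and (iii) treat one [i] at a time, the orbit at that point
   can be used instead. *)
pose n k := nth 0%N ns k.-1; pose lam k i := mu (n k, i) i.
have nk k : (1 <= k <= size ns)%N -> n k \in ns.
  by move=> /andP[k1 kq]; rewrite /n mem_nth // prednK.
have E_mu k i : (1 <= k <= size ns)%N -> E (n k) (mu (n k, i)).
  by move=> /nk/mem_ns[_ _ h]; have [] := hmu (n k, i) h.
have lamI k i : (1 <= k <= size ns)%N -> I (lam k i).
  by move=> hk; have [Kmu _] := E_mu k i hk; exact: (Lam_I (K_Lam Kmu) i).
have gap k j : (1 <= k)%N -> (k < j <= size ns)%N -> (n k + N.+1 <= n j)%N.
  move=> k1 /andP[kj jq]; have kq : (1 <= k <=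
    size ns)%N by rewrite k1 (leq_trans (ltnW kj)).
  have j1 : (1 <= j <= size ns)%N by rewrite jq (leq_trans k1) // ltnW.
  have lt : (n k < n j)%N.
    by apply: (sorted_ltn_nth ltn_trans 0%N ns_sorted); rewrite ?inE;
      move: k1 kj jq; clear; lia.
  have [_ /dvdnP[a ka] _] := mem_ns _ (nk _ kq); have [_ /dvdnP[b jb] _] :=
    mem_ns _ (nk _ j1).
  rewrite ka jb -mulSnr leq_mul2r /=; move: lt; rewrite ka jb ltn_mul2r;
    by case/andP.
have [n_kap [n_kap_in _]] := in_ns _ Kkap.
have q1 : (1 <= size ns)%N by rewrite -has_predT; apply/hasP; exists n_kap.
exists (size ns), n, lam; split; split=> //.
- split; first by have [h _ _] := mem_ns _ (nk 1%N q1); apply: leq_trans h;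
    exact: leq_maxl.
  by move=> k /andP[k1 kq]; apply: leq_trans (gap k k.+1 k1 _);
    rewrite ?leq_add2l ?ltnSn.
- by move=> k hk i; exact: lamI.
- move=> nu' Knu; have [n' [n'in En']] := in_ns _ Knu.
  exists (index n' ns).+1; first by rewrite /= index_mem.
  have nE : n (index n' ns).+1 = n' by rewrite /n /= nth_index.
  have [N'n _ E0] := mem_ns _ n'in.
  have n'1 : (1 <= n')%N by apply: leq_trans N1 _; apply: leq_trans N'n;
    exact: leq_maxl.
  move=> i; rewrite /lam nE; have [Emu hle] := hmu (n', i) E0.
  rewrite (hle _ En') andbT.
  by apply: (return_set_small qQ n'1 _ _ deltat En' Emu (hle _ En'));
    rewrite ?yN ?delta0.
- move=> i; apply: hF.
  apply: (hdom _ (u i - \sum_(0 <= k < N') seqcoord (u i) k *: e k)) => [s|];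
    last first.
    by rewrite seminorm_distC; apply: hnu.
  have n_inj : {in index_iota 1 (size ns).+1 &, injective n}.
    move=> k k'; rewrite !mem_index_iota !ltnS => hk hk' E'.
    have [kk|kk|//] := ltngtP k k'.
      by have /andP[k1 _] := hk; have /andP[_ kq] := hk'; move: (gap k k' k1);
        rewrite kk kq E' => /(_ isT); clear; lia.
    by have /andP[k1 _] := hk'; have /andP[_ kq] := hk; move: (gap k' k k1);
      rewrite kk kq E' => /(_ isT); clear; lia.
  have [[k [hk sE]]|hs] := pselect (exists k, (1 <= k <=
    size ns)%N /\ n k = s); last first.
    rewrite (seqcoord_sparse_out e_unit); last first.
      by move=> k; rewrite mem_index_iota ltnS => hk sE; apply: hs; exists k.
    by rewrite ComplexField.Normc.normc0 mulr_ge0 ?modulus_ge0.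
  have kin : k \in index_iota 1 (size ns).+1 by rewrite mem_index_iota ltnS.
  have cE := seqcoord_sparse_in e_unit
    (fun k => (1 / wprod w (lam k i) 0 (n k) `^ (1 / m%:R))%:C) (iota_uniq _ _)
      n_inj kin.
  rewrite /= in cE; rewrite -sE cE.
  have [N'n _ _] := mem_ns _ (nk _ hk).
  rewrite seqcoordB seqcoord_partial_sum // ifF ?subr0;
    last by rewrite ltnNge N'n.
  have W0 := wp_gt0 0 (n k) (lamI k i hk).
  (* After raising to the power [m], the claim follows from the bound by [2 * |u|^m], since
     [2 <= 2^m]. *)
  rewrite modulus_real gtr0_norm ?divr_gt0 ?powR_gt0 // -(ler_pXn2r m1)
    ?nnegrE; last 2 first.
  + by rewrite divr_ge0 ?powR_ge0.
  + by rewrite mulr_ge0 ?modulus_ge0.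
  have -> : (1 / wprod w (lam k i) 0 (n k) `^ (1 / m%:R)) ^+ m = (wprod w (lam
    k i) 0 (n k))^-1.
    rewrite expr_div_n expr1n div1r div1r -powR_mulrn ?powR_ge0 // -powRrM
      mulVf ?powRr1 ?ltW //.
    by rewrite pnatr_eq0 -lt0n.
  have := @return_set_inverse Q delta (n k) (mu (n k,
    i)) i 0 N qQ delta2 (yN i) (leq0n N) (E_mu k i hk).
  rewrite addn0 -/(lam k i) => /le_trans; apply.
  rewrite vE pow_prodE seqcoord_seqpow // modulusX exprMn.
  by rewrite ler_wpM2r ?exprn_ge0 ?modulus_ge0 // ler_eXnr // ler1n.
(* The positions [n j - n k + l] exceed [N], where [y] vanishes, so the orbit of [v] at time [n k]
   is itself the small majorant there. *)
- move=> k hk i l lN; apply: hF; have [Kmu Emu] := E_mu k i hk.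
  apply: (hdom _ (iter (n k) (wshift_prod w (mu (n k, i))) v i - y i)) => [s|];
    last first.
    apply: le_lt_trans (seminorm_le _ (leq_maxl Q1 q0)) _.
    by apply: le_lt_trans (Emu i) _.
  have /andP[k1 kq] := hk.
  have later j : (k < j <= size ns)%N -> (1 <= j <= size ns)%N /\ (n k +
    N.+1 <= n j)%N.
    by move=> hj; split; [move: hj k1; clear; lia | exact: gap].
  pose g j := (n j - n k + l)%N.
  have g_inj : {in index_iota k.+1 (size ns).+1 &, injective g}.
    move=> j j'; rewrite !mem_index_iota !ltnS => hj hj' E'.
    have [/andP[j1 jq] nj] := later j hj; have [/andP[j'1 j'q] nj'] :=
      later j' hj'.
    move: E'; rewrite /g => /addIn E'; have {}E' : n j = n j' by move: E' nj
      nj'; clear; lia.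
    have [jj|jj|//] := ltngtP j j'.
      by move: (gap j j' j1); rewrite jj j'q E' => /(_ isT); clear; lia.
    by move: (gap j' j j'1); rewrite jj jq E' => /(_ isT); clear; lia.
  have [[j [hj sE]]|hs] := pselect (exists j, (k < j <= size ns)%N /\ g j = s);
    last first.
    rewrite (seqcoord_sparse_out e_unit (g := g)); last first.
      by move=> j; rewrite mem_index_iota ltnS => hj sE; apply: hs; exists j.
    by rewrite ComplexField.Normc.normc0 mulr_ge0 ?modulus_ge0.
  have jin : j \in index_iota k.+1 (size ns).+1 by rewrite mem_index_iota ltnS.
  have [j1 nj] := later j hj.
  have Ikm : I (mu (n k, i) i) by exact: (Lam_I (K_Lam Kmu) i).
  have cE := seqcoord_sparse_in e_unit
    (fun j => (wprod w (lam k i) (g j) (n j + l) / wprod w (lam j i) l (n j +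
      l))%:C)
    (iota_uniq _ _) g_inj jin.
  rewrite /= in cE; rewrite -sE cE.
  rewrite seqcoordB yp; last by rewrite /g; move: nj; clear; lia.
  rewrite subr0 iter_wshift_prod (seqcoord_iter_wshift (w_adm Ikm)).
  have -> : (n k + g j = n j + l)%N by rewrite /g; move: nj; clear; lia.
  rewrite -/(wprod w (mu (n k, i) i) (g j) (n j + l)) -/(lam k i) -/(g j).
  have W1 := wp_gt0 (g j) (n j + l) Ikm; rewrite -/(lam k i) in W1.
  have W2 := wp_gt0 l (n j + l) (lamI j i j1).
  rewrite ComplexField.Normc.normcM !modulus_real (gtr0_norm W1) gtr0_norm
    ?divr_gt0 //.
  rewrite mulrCA ler_wpM2l ?(ltW W1) //.
  exact: (return_set_inverse qQ delta2 (yN i) lN (E_mu j i j1)).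
Qed.

End Necessity.

(** * Proof of the equivalence *)

Lemma pow_prod_neq0 (R : realType) (X : frechetSequenceAlgebraType R) d
  (u : 'I_d -> X) m : (1 <= m)%N -> u <> 0 -> pow_prod u m <> 0.
Proof.
move=> m1 u0 um0; apply: u0; apply/funext => i; apply: seqcoord_ext => k.
rewrite seqcoord0; apply/eqP; have /eqP :=
  congr1 (fun z => seqcoord (z i) k) um0.
by rewrite pow_prodE seqcoord_seqpow // seqcoord0 expf_eq0 m1.
Qed.

Lemma subalgebra_pow (R : realType) (X : frechetSequenceAlgebraType R) d
  (A : set ('I_d -> X)) u m : subalgebra A -> A u -> (1 <= m)%N ->
    A (pow_prod u m).
Proof.
move=> [_ _ _ mulA] Au; case: m => // m _; rewrite /pow_prod iteropS.
by elim: m => // m IH; rewrite iterS; exact: mulA.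
Qed.

Unset Implicit Arguments.

Theorem theorem2p7 (R : realType) (X : frechetSequenceAlgebraType R)
  (Fnorm : X -> R) (e : nat -> X) (I : set R) (d : nat)
  (Lam : set ('I_d -> R)) (w : R -> nat -> R) (F : nat -> R) (c C : R)
  (X_norm : has_continuous_norm X)
  (Fnorm_X : is_Fnorm Fnorm)
  (e_unit : unit_vectors e)
  (e_basis : unconditional_basis e)
  (I_interval : is_interval I) (I_neq0 : I !=set0)
  (d_ge1 : (1 <= d)%N)
  (Lam_I : Lam `<=` [set lam | forall i, I (lam i)])
  (Lam_neq0 : Lam !=set0)
  (Lam_sigma : sigma_compact Lam)
  (w_admissible : forall a, I a -> admissible X (w a))
  (w_continuous : continuous_family X I Lam w)
  (w_nondecr : forall n, (1 <= n)%N ->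
     forall a b, I a -> I b -> a <= b -> w a n <= w b n)
  (w_inf : 0 < inf [set w na.2 na.1 | na in [set n | (1 <= n)%N] `*` I])
  (F_gt0 : forall n, 0 < F n)
  (F_nondecr : forall n p, (n <= p)%N -> F n <= F p)
  (c_gt0 : 0 < c) (C_gt0 : 0 < C)
  (f := fun (n : nat) (a : R) => \sum_(1 <= k < n.+1) ln (w a k))
  (f_lipschitz : forall n, (1 <= n)%N -> forall a b, I a -> I b ->
     c * F n * `|a - b| <= `|f n a - f n b| <= C * F n * `|b - a|)
  (w_ratio : forall n, (1 <= n)%N -> forall a b, I a -> I b ->
     c <= w a n / w b n) :
  let condA :=
    exists A : set ('I_d -> X), common_hypercyclic_algebra Lam w A in
  let condB :=
    forall m, (1 <= m)%N ->
      exists u : 'I_d -> X,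
        common_hypercyclic Lam (wshift_prod w) (pow_prod u m) in
  let condC :=
    forall (m : nat) (tau : R) (N : nat) (eps : R) (K : set ('I_d -> R)),
      (1 <= m)%N -> 0 < tau -> (1 <= N)%N -> 0 < eps ->
      compact K -> K `<=` Lam ->
      exists (q : nat) (n : nat -> nat) (lam : nat -> 'I_d -> R),
        [/\ (1 <= q)%N,
            (N <= n 1)%N /\
              (forall k, (1 <= k < q)%N -> (n k + N <= n k.+1)%N) &
            (forall k, (1 <= k <= q)%N -> forall i, I (lam k i))] /\
        [/\ K `<=` \bigcup_(k in [set k | (1 <= k <= q)%N])
                     [set mu | forall l,
                        lam k l - tau / F (n k) <= mu l <= lam k l],
            (forall i : 'I_d,
               Fnorm (\sum_(1 <= k < q.+1)
                 (1 / (\prod_(1 <= v < (n k).+1) w (lam k i) v)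
                        `^ (1 / m%:R))%:C *: e (n k)) < eps) &
            (forall k, (1 <= k <= q)%N -> forall (i : 'I_d) l, (l <= N)%N ->
               Fnorm (\sum_(k.+1 <= j < q.+1)
                 ((\prod_(n j - n k + l + 1 <= v < (n j + l).+1)
                     w (lam k i) v) /
                  (\prod_(l + 1 <= v < (n j + l).+1) w (lam j i) v))%:C
                 *: e (n j - n k + l)%N) < eps)] in
  (condA <-> condB) /\ (condB <-> condC).
Proof.
move=> condA condB condC.
have [q0 norm_q0] := continuous_norm_index X_norm.
have adm lam i : Lam lam -> admissible X (w (lam i)).
  by move=> Ll; apply: w_admissible; exact: Lam_I Ll i.
have coveringE m tau N eps K : condC -> (1 <= m)%N -> 0 < tau -> (1 <= N)%N ->
  0 < eps ->
    compact K -> K `<=` Lam -> covering Fnorm e I w F m tau N eps K.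
  move=> hC m1 tau0 N1 eps0 cK KL.
  have [q [n [lam [h1 [h2 h3 h4]]]]] := hC m tau N eps K m1 tau0 N1 eps0 cK KL.
  exists q, n, lam; split=> //; split=> // k hk i l lN.
  have := h4 k hk i l lN; congr (Fnorm _ < _).
  by apply: eq_bigr => j _; rewrite /wprod !addn1.
have AB : condA -> condB.
  move=> [A [subA [u [Au u0]] hA]] m m1; exists u; apply: hA; split.
    exact: subalgebra_pow.
  exact: pow_prod_neq0.
have BC : condB -> condC.
  move=> hB m tau N eps K m1 tau0 N1 eps0 cK KL; have [u hu] := hB m m1.
  have [lam0 L0] := Lam_neq0.
  (* Since (c) requires [q >= 1] even when [K] is empty, a point of [Lam] is added to [K]. *)
  have cK' : compact (K `|` [set lam0]) by apply: compactU => //;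
    exact: compact_set1.
  have KL' : K `|` [set lam0] `<=` Lam by move=> lam [/KL //|->].
  pose y (_ : 'I_d) := \sum_(0 <= k < N.+1) (1 : R[i]) *: e k.
  have yE i k : seqcoord (y i) k = (k <= N)%:R.
    by rewrite /y seqcoord_partial_sum // ltnS; case: (k <= N)%N.
  have f_lo n : (1 <= n)%N -> forall a b, I a -> I b -> c * F n * `|a - b| <=
    `|f n a - f n b|.
    by move=> n1 a b Ia Ib; have /andP[] := f_lipschitz n n1 a b Ia Ib.
  have [q [n [lam [h1 [h2 h3 h4]]]]] := covering_of_power Fnorm_X e_unit
    norm_q0 e_basis Lam_I
    w_admissible w_continuous w_nondecr F_gt0 c_gt0 f_lo cK' KL' hu erefl yE m1
      tau0 N1 eps0
    (ex_intro _ lam0 (or_intror erefl)).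
  exists q, n, lam; split=> //; split=> //; first by move=> mu Kmu; apply: h2;
    left.
  move=> k hk i l lN; have := h4 k hk i l lN; congr (Fnorm _ < _).
  by apply: eq_bigr => j _; rewrite /wprod !addn1.
have CA : condC -> condA.
  move=> hC; apply: (hypercyclic_algebra_criterion e_unit norm_q0 e_basis d_ge1
    Lam_neq0
    Lam_sigma adm w_continuous) => m t K y x p q eta m1 cK KL eta0 yp xp.
  have f_up n : (1 <= n)%N -> forall a b, I a -> I b -> `|f n a - f n b| <=
    C * F n * `|b - a|.
    by move=> n1 a b Ia Ib; have /andP[] := f_lipschitz n n1 a b Ia Ib.
  apply: (covering_dense Fnorm_X e_unit norm_q0 e_basis I_neq0 Lam_I
    w_admissible w_nondecr
    w_inf F_gt0 F_nondecr c_gt0 C_gt0 w_ratio f_up t q m1 KL eta0 yp xp) => tau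
      N eps tau0 N1 eps0.
  exact: coveringE.
by split; split=> // h; [exact/CA/BC | exact/AB/CA].
Qed.
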